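(* The emptiness problem for $\mathrm{PWP}_{\circlearrowleft}$ terms on $\mathsf{DREL}_{\mathtt{test}}$ is $\Pi^0_1$-complete; likewise, the emptiness problem for $\mathrm{PWP}_{\circlearrowleft}$ terms on $\mathsf{DREL}^{\mathrm{fin}}_{\mathtt{test}}$ is $\Pi^0_1$-complete. Here the emptiness problem on a class $\mathcal{K}$ is: given a $\mathrm{PWP}_{\circlearrowleft}$ term $t$, decide whether $\hat{v}(t)=\emptyset$ for every valuation $v\in\mathcal{K}$.
   Context: Fix disjoint countably infinite sets $\mathbf{P}$ (primitive tests) and $\mathbf{A}$ (actions) of variables, with a fixpoint-free involution $p\mapsto\tilde p$ on $\mathbf{P}$. Terms are built from variables and the constants $\mathrm{I}$, $0$ using binary $;$ (composition), $+$ (union), $\cap$ (intersection) and unary ${}^*$ (reflexive transitive closure); write $t^{\circlearrowleft}:=t\cap \mathrm{I}$. A valuation $v$ over a nonempty set $B$ assigns to each variable a binary relation on $B$, and is extended to terms by $\hat v(\mathrm{I})=\{(x,x):x\in B\}$, $\hat v(0)=\emptyset$, $;\,$ = relational composition, $+$ = union, $\cap$ = intersection, ${}^*$ = reflexive transitive closure. $\mathsf{DREL}_{\mathtt{test}}$ is the class of all valuations (over any nonempty set $B$) such that every variable is interpreted as a partial function ($\hat v(a)^{-1};\hat v(a)\subseteq \hat v(\mathrm{I})$) and, for each $p\in\mathbf{P}$, $v(p)\subseteq\hat v(\mathrm{I})$ and $v(\tilde p)=\hat v(\mathrm{I})\setminus v(p)$. $\mathsf{DREL}^{\mathrm{fin}}_{\mathtt{test}}$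 is its subclass with $B$ finite. Tests form the smallest set containing $\mathbf{P}$, $\mathrm{I}$, $0$ and closed under $;$ and $+$; for a test $b$ its complement $\tilde b$ is defined by $\tilde p$ as given, $\tilde{\mathrm{I}}=0$, $\tilde 0=\mathrm{I}$, $\widetilde{b+c}=\tilde b;\tilde c$, $\widetilde{b;c}=\tilde b+\tilde c$. Put $t+_b u:=b;t+\tilde b;u$ and $t^{*_b}:=(b;t)^*;\tilde b$. The $\mathrm{PWP}_{\circlearrowleft}$ terms (propositional while programs with loop) form the smallest set containing all tests and all actions and closed under $t;u$, $t+_b u$ ($b$ a test), $t^{*_b}$ ($b$ a test), and $t^{\circlearrowleft}$. *)

(* Defs.v *)
From Stdlib Require Import Relation_Operators.
From mathcomp Require Import all_boot.
From mathcomp Require Import boolp classical_sets functions cardinality.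

Set Implicit Arguments.
Unset Strict Implicit.
Unset Printing Implicit Defensive.

(* Total recursive functions: the least class of number-theoretic functions
   containing zero, successor and projections, and closed under composition,
   primitive recursion and minimisation of regular functions, i.e. of those f
   such that for every v some k satisfies f (k, v) = 0. In [rec_prim] the
   recursion variable is the first component. *)
Inductive recursive : forall n : nat, (n.-tuple nat -> nat) -> Prop :=
| rec_zero n : @recursive n (fun=> 0)
| rec_succ : @recursive 1 (fun v => (thead v).+1)
| rec_proj n (i : 'I_n) : @recursive n (fun v => tnth v i)
| rec_comp m n (h : m.-tuple nat -> nat) (g : 'I_m -> n.-tuple nat -> nat) :
    recursive h -> (forall i, recursive (g i)) ->
    @recursive n (fun v => h [tuple g i v | i < m])
| rec_prim n (f : n.-tuple nat -> nat) (h : n.+2.-tuple nat -> nat)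
    (g : n.+1.-tuple nat -> nat) :
    recursive f -> recursive h ->
    (forall v : n.-tuple nat, g [tuple of 0 :: v] = f v) ->
    (forall k (v : n.-tuple nat),
        g [tuple of k.+1 :: v] = h [tuple of k :: g [tuple of k :: v] :: v]) ->
    recursive g
| rec_mu n (f : n.+1.-tuple nat -> nat) (g : n.-tuple nat -> nat) :
    recursive f ->
    (forall v : n.-tuple nat, f [tuple of g v :: v] = 0) ->
    (forall (v : n.-tuple nat) k, k < g v -> f [tuple of k :: v] <> 0) ->
    recursive g.

Definition recursive1 (f : nat -> nat) : Prop :=
  @recursive 1 (fun v => f (thead v)).

Definition recursive_rel (r : rel nat) : Prop :=
  @recursive 2 (fun v => nat_of_bool (r (tnth v ord0) (tnth v ord_max))).

Definition Pi01 (S : set nat) : Prop :=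
  exists2 r : rel nat, recursive_rel r & forall x, S x <-> forall y, r x y.

Definition many_one_reducible (S T : set nat) : Prop :=
  exists2 f : nat -> nat, recursive1 f & forall x, S x <-> T (f x).

Definition Pi01_complete (T : set nat) : Prop :=
  Pi01 T /\ forall S, Pi01 S -> many_one_reducible S T.

(* The set of variables is the disjoint union P + A. *)
Inductive term (P A : Type) : Type :=
| Var of P + A
| One
| Zero
| Seq of term P A & term P A
| Plus of term P A & term P A
| Cap of term P A & term P A
| Star of term P A.

Arguments One {P A}.
Arguments Zero {P A}.

Definition prim {P A : Type} (p : P) : term P A := Var (inl p).
Definition act {P A : Type} (a : A) : term P A := Var (inr a).

Definition loop {P A : Type} (t : term P A) : term P A := Cap t One.

Definition valuation (P A B : Type) := P + A -> B -> B -> Prop.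

Fixpoint eval {P A B : Type} (v : valuation P A B) (t : term P A)
    : B -> B -> Prop :=
  match t with
  | Var x => v x
  | One => fun x y => x = y
  | Zero => fun _ _ => False
  | Seq t u => fun x y => exists2 z, eval v t x z & eval v u z y
  | Plus t u => fun x y => eval v t x y \/ eval v u x y
  | Cap t u => fun x y => eval v t x y /\ eval v u x y
  | Star t => clos_refl_trans B (eval v t)
  end.

Definition drel_test {P A : Type} (tilde : P -> P) (B : Type)
    (v : valuation P A B) : Prop :=
  [/\ inhabited B,
      forall (a : P + A) x y z, v a x y -> v a x z -> y = z,
      forall (p : P) x y, v (inl p) x y -> x = y
    & forall (p : P) x y, v (inl (tilde p)) x y <-> x = y /\ ~ v (inl p) x y].

Definition drel_test_fin {P A : Type} (tilde : P -> P) (B : Type)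
    (v : valuation P A B) : Prop :=
  drel_test tilde v /\ finite_set [set: B].

Inductive test {P A : Type} : term P A -> Prop :=
| test_prim p : test (prim p)
| test_one : test One
| test_zero : test Zero
| test_seq b c : test b -> test c -> test (Seq b c)
| test_plus b c : test b -> test c -> test (Plus b c).

(* Only meaningful on tests; the value on other terms is irrelevant. *)
Fixpoint compl {P A : Type} (tilde : P -> P) (b : term P A) : term P A :=
  match b with
  | Var (inl p) => prim (tilde p)
  | One => Zero
  | Zero => One
  | Plus b c => Seq (compl tilde b) (compl tilde c)
  | Seq b c => Plus (compl tilde b) (compl tilde c)
  | _ => b
  end.

Definition ite {P A : Type} (tilde : P -> P) (b t u : term P A) : term P A :=
  Plus (Seq b t) (Seq (compl tilde b) u).

Definition while {P A : Type} (tilde : P -> P) (b t : term P A) : term P A :=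
  Seq (Star (Seq b t)) (compl tilde b).

Inductive pwp {P A : Type} (tilde : P -> P) : term P A -> Prop :=
| pwp_test b : test b -> pwp tilde b
| pwp_act a : pwp tilde (act a)
| pwp_seq t u : pwp tilde t -> pwp tilde u -> pwp tilde (Seq t u)
| pwp_ite b t u :
    test b -> pwp tilde t -> pwp tilde u -> pwp tilde (ite tilde b t u)
| pwp_while b t : test b -> pwp tilde t -> pwp tilde (while tilde b t)
| pwp_loop t : pwp tilde t -> pwp tilde (loop t).

(* Cantor's pairing function (m + n) (m + n + 1) / 2 + m. *)
Definition cpair (m n : nat) : nat := 'C((m + n).+1, 2) + m.

(* Goedel numbering of terms, relative to numberings of the variables. *)
Fixpoint code {P A : Type} (codeP : P -> nat) (codeA : A -> nat)
    (t : term P A) : nat :=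
  match t with
  | Var (inl p) => cpair 0 (codeP p)
  | Var (inr a) => cpair 1 (codeA a)
  | One => cpair 2 0
  | Zero => cpair 3 0
  | Seq t u => cpair 4 (cpair (code codeP codeA t) (code codeP codeA u))
  | Plus t u => cpair 5 (cpair (code codeP codeA t) (code codeP codeA u))
  | Cap t u => cpair 6 (cpair (code codeP codeA t) (code codeP codeA u))
  | Star t => cpair 7 (code codeP codeA t)
  end.

Definition empty_on {P A : Type} (K : forall B : Type, valuation P A B -> Prop)
    (t : term P A) : Prop :=
  forall (B : Type) (v : valuation P A B), K B v -> forall x y, ~ eval v t x y.

(* The emptiness problem on K as a set of Goedel numbers of PWP-with-loop
   terms. *)
Definition emptiness_problem {P A : Type} (tilde : P -> P)
    (codeP : P -> nat) (codeA : A -> nat)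
    (K : forall B : Type, valuation P A B -> Prop) : set nat :=
  fun n => exists t : term P A,
    [/\ code codeP codeA t = n, pwp tilde t & empty_on K t].

(* Main.v *)
Require Import Defs.
From Stdlib Require Import Relation_Operators Operators_Properties.
From mathcomp Require Import all_boot.
From mathcomp Require Import zify.
From mathcomp Require Import boolp cardinality.

(* A term is positive apart from the primitive tests [tilde p], so a nonempty
   value over any structure is witnessed by finitely many facts [eval v t a b],
   and these already generate a finite structure. Emptiness is therefore the
   same problem on both classes, and it is co-r.e.: search for a consistent list
   of facts in which each follows from later ones.

   For hardness, a while program with counters is simulated on a grid whose rows
   are the successive states of the computation, each counter being stored in
   unary by a test along the row. A state is represented by the first point of
   its row. An elementary instruction walks along the row and back before moving
   up; at every point of the walk, terms of the form [loop t] make a short round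
   trip to the next row and check that it is glued correctly to the current one
   and holds the updated counters. Hence in every structure in which the term is
   nonempty, the walk follows a genuine computation. *)

Set Implicit Arguments.
Unset Strict Implicit.
Unset Printing Implicit Defensive.

(** * Recursive functions *)

(** The obstacle to soundness is that actions are merely partial functions: nothing makes [left]
    invert [right] or [down] invert [up], and a term can compare two points only by returning to its
    starting point. So the invariant of a row includes that [left] undoes [right] along it, and the
    trips around the squares above a row establish this for the next row. Distinct rows may share
    points; this is harmless, as only the sequence of visited rows with their marks is read as a
    computation.

    The common length of the rows is chosen by the structure. A halting computation fits into some
    length, whereas a diverging one leaves the term empty for every length.

    For completeness the computation is laid out on the infinite grid [nat * nat], where no move up
    or to the right leaves the grid. A finite structure is then obtained from a certificate, not
    from a rectangle with borders. For this reason membership and hardness are both proved for an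
    arbitrary class [K] between the finite structures and all structures. *)

Lemma recursive_ext n (f g : n.-tuple nat -> nat) :
  f =1 g -> recursive f -> recursive g.
Proof. by move/funext->. Qed.

Definition recursive2 (h : nat -> nat -> nat) : Prop :=
  @recursive 2 (fun v => h (tnth v ord0) (tnth v ord_max)).

Definition recursive3 (h : nat -> nat -> nat -> nat) : Prop :=
  @recursive 3 (fun v => h (tnth v ord0) (tnth v (@inord 2 1)) (tnth v ord_max)).

Section Composition.
Variable n : nat.
Implicit Type f g : n.-tuple nat -> nat.

Lemma recursive_app1 (h : nat -> nat) f :
  recursive1 h -> recursive f -> recursive (fun v => h (f v)).
Proof.
move=> hP fP; apply: recursive_ext (rec_comp hP (fun=> fP)) => v /=.
by rewrite /thead tnth_mktuple.
Qed.

Lemma recursive_app2 (h : nat -> nat -> nat) f g :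
  recursive2 h -> recursive f -> recursive g -> recursive (fun v => h (f v) (g v)).
Proof.
move=> hP fP gP.
have iP (i : 'I_2) : recursive (if i == ord0 then f else g) by case: ifP.
by apply: recursive_ext (rec_comp hP iP) => v /=; rewrite !tnth_mktuple.
Qed.

Lemma recursive_app3 (h : nat -> nat -> nat -> nat) f g e :
  recursive3 h -> recursive f -> recursive g -> recursive e ->
  recursive (fun v => h (f v) (g v) (e v)).
Proof.
move=> hP fP gP eP.
have iP (i : 'I_3) :
  recursive (if i == ord0 then f else if i == inord 1 then g else e).
  by do 2?case: ifP.
apply: recursive_ext (rec_comp hP iP) => v /=.
rewrite !tnth_mktuple eqxx.
by rewrite -!val_eqE /= !inordK.
Qed.

Lemma recursive_const c : recursive (fun _ : n.-tuple nat => c).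
Proof.
by elim: c => [|c IH]; [exact: rec_zero | exact: (recursive_app1 rec_succ IH)].
Qed.

End Composition.

Lemma recursive2_rec (a : nat -> nat) (h : nat -> nat -> nat -> nat) :
  recursive1 a -> recursive3 h ->
  recursive2 (fun k x => nat_rect (fun=> nat) (a x) (fun i acc => h i acc x) k).
Proof.
move=> aP hP; apply: (rec_prim aP hP) => [v|k v]; rewrite /thead !(tnth_nth 0) //=.
by rewrite inordK.
Qed.

Lemma recursive2_mu (f : nat -> nat -> bool) (g : nat -> nat) :
  recursive2 (fun k x => f k x) -> (forall x, ~~ f (g x) x) ->
  (forall x k, k < g x -> f k x) -> recursive1 g.
Proof.
move=> fP g0 gmin; apply: (rec_mu fP) => [v|v k]; rewrite /thead !(tnth_nth 0) /=.
  by have := g0 (nth 0 v 0); case: (f _ _).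
by move/gmin; case: (f _ _).
Qed.

(** * Inverses of the Cantor pairing function *)

Definition cdiag_subproof n : exists w, n < 'C(w.+2, 2).
Proof. by exists n; rewrite binS bin1; lia. Qed.

(** ['C(w.+1, 2)] is a triangular number, so this is the index of the antidiagonal on which the pair
    coded by [n] lies. Defining it as a least witness makes it recursive by minimisation. *)
Definition cdiag n := ex_minn (cdiag_subproof n).
Definition cfst n := n - 'C((cdiag n).+1, 2).
Definition csnd n := cdiag n - cfst n.

Lemma bin2S n : 'C(n.+1, 2) = 'C(n, 2) + n.
Proof. by rewrite binS bin1. Qed.

Lemma leq_bin2 m n : m <= n -> 'C(m, 2) <= 'C(n, 2).
Proof. exact: leq_bin2l. Qed.

Lemma cdiagP n : 'C((cdiag n).+1, 2) <= n < 'C((cdiag n).+2, 2).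
Proof.
rewrite /cdiag; case: ex_minnP => w -> wmin; rewrite andbT.
case: w wmin => [//|w] wmin; rewrite leqNgt; apply/negP => /wmin.
by rewrite ltnn.
Qed.

Lemma cdiagE n w : 'C(w.+1, 2) <= n < 'C(w.+2, 2) -> cdiag n = w.
Proof.
case/andP=> wn nw; have /andP[dn nd] := cdiagP n; apply/eqP.
rewrite eqn_leq; apply/andP; split; rewrite leqNgt; apply/negP => lt.
  by have := leq_bin2 (lt : w.+2 <= (cdiag n).+1); lia.
by have := leq_bin2 (lt : (cdiag n).+2 <= w.+1); lia.
Qed.

Lemma cdiag_cpair m n : cdiag (cpair m n) = m + n.
Proof. by apply: cdiagE; rewrite /cpair (bin2S (m + n).+1); lia. Qed.

Lemma cfst_cpair m n : cfst (cpair m n) = m.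
Proof. by rewrite /cfst cdiag_cpair /cpair addKn. Qed.

Lemma csnd_cpair m n : csnd (cpair m n) = n.
Proof. by rewrite /csnd cdiag_cpair cfst_cpair addKn. Qed.

Lemma cpair_fst_snd n : cpair (cfst n) (csnd n) = n.
Proof.
have := cdiagP n; rewrite /csnd /cpair (bin2S (cdiag n).+1) => /andP[h1 h2].
have h : cfst n <= cdiag n by rewrite /cfst; lia.
by rewrite subnKC // /cfst subnKC.
Qed.

Definition cpairE := (cfst_cpair, csnd_cpair).

Lemma cpair_inj m n m' n' : cpair m n = cpair m' n' -> m = m' /\ n = n'.
Proof.
by move=> e; split; [rewrite -(cfst_cpair m n) e | rewrite -(csnd_cpair m n) e];
  rewrite cpairE.
Qed.

Lemma leq_cpair_r m n : n <= cpair m n.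
Proof. by rewrite /cpair bin2S; lia. Qed.

Lemma ltn_cpair_r m n : 0 < m -> n < cpair m n.
Proof. by rewrite /cpair bin2S; lia. Qed.

Lemma leq_cpair_l m n : m <= cpair m n.
Proof. by rewrite /cpair; lia. Qed.

Lemma leq_cfst n : cfst n <= n.
Proof. by rewrite -[leqRHS]cpair_fst_snd leq_cpair_l. Qed.

Lemma leq_csnd n : csnd n <= n.
Proof. by rewrite -[leqRHS]cpair_fst_snd leq_cpair_r. Qed.

(** * Closure properties of unary recursive functions *)

Lemma rec_id : recursive1 id.
Proof. exact: rec_proj. Qed.

Lemma rec_const c : recursive1 (fun=> c).
Proof. exact: recursive_const. Qed.

Lemma rec_comp1 f g : recursive1 f -> recursive1 g -> recursive1 (fun x => f (g x)).
Proof. exact: recursive_app1. Qed.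

Lemma rec_comp2 h f g :
  recursive2 h -> recursive1 f -> recursive1 g -> recursive1 (fun x => h (f x) (g x)).
Proof. exact: recursive_app2. Qed.

Lemma recursive2_ext h h' : h =2 h' -> recursive2 h -> recursive2 h'.
Proof. by move=> e; apply: recursive_ext => v; rewrite e. Qed.

Lemma recursive2_swap h : recursive2 h -> recursive2 (fun x y => h y x).
Proof. by move=> hP; apply: (recursive_app2 hP); apply: rec_proj. Qed.

Lemma recursive2_add : recursive2 addn.
Proof.
apply: recursive2_ext (recursive2_rec rec_id (h := fun _ acc _ => acc.+1) _) => [k x|].
  by elim: k => //= k ->.
by apply: recursive_app1 rec_succ _; apply: rec_proj.
Qed.

Lemma rec_pred : recursive1 predn.
Proof.
have h := recursive2_rec (rec_const 0) (h := fun i _ _ => i) (rec_proj _).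
apply: recursive_ext (recursive_app2 h (rec_proj ord0) (rec_proj ord0)) => v.
by rewrite /thead; case: (tnth v ord0).
Qed.

Lemma recursive2_sub : recursive2 subn.
Proof.
apply: (@recursive2_swap (fun k x => x - k)).
apply: recursive2_ext (recursive2_rec rec_id (h := fun _ acc _ => acc.-1) _) => [k x|].
  by elim: k => [|k /= ->]; rewrite ?subn0 // subnS.
by apply: recursive_app1 rec_pred _; apply: rec_proj.
Qed.

Lemma rec_eq0 : recursive1 (fun n => n == 0).
Proof.
by apply: recursive_ext (recursive_app2 recursive2_sub (recursive_const _ 1) rec_id) => v;
  case: (thead v).
Qed.

Lemma recursive3_if : recursive3 (fun b x y => if b == 0 then y else x).
Proof.
have h1 : recursive3 (fun b x y =>
  nat_rect (fun=> nat) y (fun i acc => x) b).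
  pose f (v : 2.-tuple nat) := tnth v ord_max.
  have fP : recursive f by apply: rec_proj.
  pose h' (v : 4.-tuple nat) := tnth v (inord 2).
  have h'P : recursive h' by apply: rec_proj.
  apply: (rec_prim fP h'P) => [v|k v]; rewrite /f /h' !(tnth_nth 0) //=.
  by rewrite !inordK.
by apply: recursive_ext h1 => v; case: (tnth v ord0).
Qed.

Lemma rec_add f g :
  recursive1 f -> recursive1 g -> recursive1 (fun x => f x + g x).
Proof. exact: rec_comp2 recursive2_add. Qed.

Lemma rec_sub f g :
  recursive1 f -> recursive1 g -> recursive1 (fun x => f x - g x).
Proof. exact: rec_comp2 recursive2_sub. Qed.

Lemma rec_succ1 f : recursive1 f -> recursive1 (fun x => (f x).+1).
Proof. exact: rec_comp1 (rec_succ). Qed.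

Lemma recursive2_leq : recursive2 (fun m n => m <= n).
Proof. exact: recursive_app1 rec_eq0 recursive2_sub. Qed.

Lemma rec_bin2 : recursive1 (fun n => 'C(n, 2)).
Proof.
have hP : recursive3 (fun i acc _ => acc + i).
  by apply: recursive_app2 recursive2_add _ _; apply: rec_proj.
have h := recursive2_rec (rec_const 0) hP.
apply: recursive_ext (recursive_app2 h (rec_proj ord0) (rec_proj ord0)) => v.
by rewrite /thead; elim: (tnth v ord0) => //= k ->; rewrite bin2S.
Qed.

Lemma recursive2_cpair : recursive2 cpair.
Proof.
apply: recursive_app2 recursive2_add _ (rec_proj _).
by apply: recursive_app1 (rec_comp1 rec_bin2 rec_succ) recursive2_add.
Qed.

Lemma rec_cpair f g :
  recursive1 f -> recursive1 g -> recursive1 (fun x => cpair (f x) (g x)).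
Proof. exact: rec_comp2 recursive2_cpair. Qed.

Lemma rec_cdiag : recursive1 cdiag.
Proof.
apply: (@recursive2_mu (fun k x => 'C(k.+2, 2) <= x)).
- apply: recursive_app2 recursive2_leq _ (rec_proj _).
  by apply: recursive_app1 (rec_comp1 rec_bin2 (rec_succ1 rec_succ)) (rec_proj _).
- by move=> x; rewrite -ltnNge; have /andP[] := cdiagP x.
- move=> x k; rewrite /cdiag; case: ex_minnP => w _ wmin kw.
  by rewrite leqNgt; apply/negP => /wmin; rewrite leqNgt kw.
Qed.

Lemma rec_cfst1 : recursive1 cfst.
Proof.
apply: rec_sub rec_id _; apply: rec_comp1 rec_bin2 _.
exact: rec_succ1 rec_cdiag.
Qed.

Lemma rec_cfst f : recursive1 f -> recursive1 (fun x => cfst (f x)).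
Proof. exact: rec_comp1 rec_cfst1. Qed.

Lemma rec_csnd f : recursive1 f -> recursive1 (fun x => csnd (f x)).
Proof. by apply: rec_comp1; apply: rec_sub rec_cdiag rec_cfst1. Qed.

Lemma recursive2_curry (h : nat -> nat -> nat) :
  recursive1 (fun z => h (cfst z) (csnd z)) -> recursive2 h.
Proof.
move=> hP; apply: recursive_ext (recursive_app1 hP recursive2_cpair) => v.
by rewrite !cpairE.
Qed.

Lemma recursive3_curry (h : nat -> nat -> nat -> nat) :
  recursive1 (fun z => h (cfst z) (cfst (csnd z)) (csnd (csnd z))) -> recursive3 h.
Proof.
move=> hP; have c3 : recursive3 (fun x y z => cpair x (cpair y z)).
  apply: recursive_app2 recursive2_cpair (rec_proj _) _.
  by apply: recursive_app2 recursive2_cpair (rec_proj _) (rec_proj _).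
by apply: recursive_ext (recursive_app1 hP c3) => v; rewrite !cpairE.
Qed.

(** Packing the three arguments of the step into one number keeps all recursiveness goals unary,
    which is the form that [rec_tac] decomposes. *)
Lemma rec_nat_rect (a n : nat -> nat) (h : nat -> nat -> nat -> nat) :
  recursive1 a -> recursive1 (fun z => h (cfst z) (cfst (csnd z)) (csnd (csnd z))) ->
  recursive1 n ->
  recursive1 (fun x => nat_rect (fun=> nat) (a x) (h x) (n x)).
Proof.
move=> aP hP nP.
have h3 : recursive3 (fun i acc x => h x i acc).
  apply: recursive3_curry.
  have cP : recursive1 (fun z => cpair (csnd (csnd z)) (cpair (cfst z) (cfst (csnd z)))).
    by do !(apply: rec_cpair || apply: rec_cfst || apply: rec_csnd || apply: rec_id).
  by apply: recursive_ext (rec_comp1 hP cP) => v; rewrite !cpairE.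
apply: recursive_ext (rec_comp2 (recursive2_rec aP h3) nP rec_id) => v.
by elim: (n _) => //= k ->.
Qed.

Lemma rec_if (P : nat -> bool) f g :
  recursive1 (fun x => P x) -> recursive1 f -> recursive1 g ->
  recursive1 (fun x => if P x then f x else g x).
Proof.
move=> PP fP gP; apply: recursive_ext (recursive_app3 recursive3_if PP fP gP) => v.
by case: (P _).
Qed.

Lemma rec_ifb (P Q R : nat -> bool) :
  recursive1 (fun x => P x) -> recursive1 (fun x => Q x) -> recursive1 (fun x => R x) ->
  recursive1 (fun x => if P x then Q x else R x).
Proof.
by move=> PP QP RP; apply: recursive_ext (rec_if PP QP RP) => v; case: (P _).
Qed.

Lemma rec_leq f g :
  recursive1 f -> recursive1 g -> recursive1 (fun x => f x <= g x).
Proof. exact: rec_comp2 recursive2_leq. Qed.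

Lemma rec_not P : recursive1 (fun x => nat_of_bool (P x)) ->
  recursive1 (fun x => ~~ P x).
Proof. by move=> PP; apply: rec_ifb PP (rec_const false) (rec_const true). Qed.

Lemma rec_and P Q : recursive1 (fun x => nat_of_bool (P x)) ->
  recursive1 (fun x => nat_of_bool (Q x)) -> recursive1 (fun x => P x && Q x).
Proof. by move=> PP QP; apply: rec_ifb PP QP (rec_const false). Qed.

Lemma rec_or P Q : recursive1 (fun x => nat_of_bool (P x)) ->
  recursive1 (fun x => nat_of_bool (Q x)) -> recursive1 (fun x => P x || Q x).
Proof. by move=> PP QP; apply: rec_ifb PP (rec_const true) QP. Qed.

Lemma rec_eq f g :
  recursive1 f -> recursive1 g -> recursive1 (fun x => f x == g x).
Proof.
move=> fP gP; apply: recursive_ext (rec_and (rec_leq fP gP) (rec_leq gP fP)) => v.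
by rewrite eqn_leq.
Qed.

(** Bounded quantifiers with their own head symbols, so that [rec_tac] can recognise them. *)
Definition exb n (P : nat -> bool) := has P (iota 0 n).
Definition allb n (P : nat -> bool) := ~~ exb n (fun i => ~~ P i).

Lemma exbP n (P : nat -> bool) : reflect (exists2 i, i < n & P i) (exb n P).
Proof.
by apply: (iffP hasP) => -[i]; rewrite ?mem_iota => lt Pi; exists i; rewrite ?mem_iota.
Qed.

Lemma allbP n (P : nat -> bool) : reflect (forall i, i < n -> P i) (allb n P).
Proof.
apply: (iffP idP) => [|h].
  move=> + i lt; apply: contraR => nP; apply/exbP; by exists i.
by apply/exbP => -[i /h ->].
Qed.

Lemma rec_exb (P : nat -> nat -> bool) n :
  recursive1 (fun z => P (cfst z) (csnd z)) -> recursive1 n ->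
  recursive1 (fun x => exb (n x) (P x)).
Proof.
move=> PP nP.
have sP : recursive1 (fun z => cpair (cfst z) (cfst (csnd z))).
  by do !(apply: rec_cpair || apply: rec_cfst || apply: rec_csnd || apply: rec_id).
have := rec_nat_rect (a := fun=> 0)
  (h := fun x i acc => if acc == 0 then nat_of_bool (P x i) else 1).
move=> /(_ n (rec_const _) _ nP) H.
apply: recursive_ext (H _) => [v|]; last first.
  apply: rec_if (rec_comp1 rec_eq0 _) _ (rec_const _).
    by do !(apply: rec_cpair || apply: rec_cfst || apply: rec_csnd || apply: rec_id).
  by apply: recursive_ext (rec_comp1 PP sP) => w; rewrite !cpairE.
rewrite /exb; elim: (n _) => // k.
rewrite -[in iota _ k.+1]addn1 iotaD has_cat [has _ (iota (0 + k) 1)]/= orbF /= => ->.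
by case: has.
Qed.

Lemma rec_allb (P : nat -> nat -> bool) n :
  recursive1 (fun z => P (cfst z) (csnd z)) -> recursive1 n ->
  recursive1 (fun x => allb (n x) (P x)).
Proof.
move=> PP nP; apply: rec_not.
by apply: (@rec_exb (fun x i => ~~ P x i)) => //; apply: rec_not.
Qed.

(* Every number codes the infinite sequence [cnth s 0, cnth s 1, ...], which is
   eventually 0 as [cpair 0 0 = 0]. *)
Definition cnth s i := cfst (iter i csnd s).

Lemma cnth_ex (F : nat -> nat) m : exists s, forall i, i < m -> cnth s i = F i.
Proof.
elim: m F => [|m IH] F; first by exists 0.
have [s sP] := IH (F \o succn); exists (cpair (F 0) s) => -[_|i im].
  by rewrite /cnth cpairE.
by rewrite /cnth iterSr cpairE; apply: sP.
Qed.

Lemma rec_cnth f g :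
  recursive1 f -> recursive1 g -> recursive1 (fun x => cnth (f x) (g x)).
Proof.
move=> fP gP; apply: rec_cfst.
have := rec_nat_rect (h := fun _ _ acc => csnd acc) fP _ gP => H.
apply: recursive_ext (H _) => [v|].
  by elim: (g _) => //= k ->.
by do !(apply: rec_cfst || apply: rec_csnd || apply: rec_id).
Qed.

(** * Course-of-values recursion *)

Section StrongRecursion.
Variable Phi : nat -> nat -> nat.

(** The history nests pairs with the newest value outermost. Hence in the table of length [n] the
    value at [i] sits at position [n - i.+1]. *)
Definition strong_table : nat -> nat :=
  nat_rect (fun=> nat) 0 (fun n s => cpair (Phi n s) s).

Definition strong n := cfst (strong_table n.+1).

Lemma strongE n : strong n = Phi n (strong_table n).
Proof. by rewrite /strong /= cpairE. Qed.

Lemma strong_tableE n i : i < n -> cnth (strong_table n) (n - i.+1) = strong i.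
Proof.
elim: n i => // n IH i; rewrite ltnS leq_eqVlt => /orP[/eqP ->|lt].
  by rewrite subnn /cnth /strong.
by rewrite subSn // /cnth iterSr /= cpairE; apply: IH.
Qed.

Lemma rec_strong : recursive2 Phi -> recursive1 strong.
Proof.
move=> PP; apply: rec_comp1 rec_cfst1 _.
apply: (rec_nat_rect (h := fun _ n s => cpair (Phi n s) s)) (rec_const _) _ _.
  by apply: rec_cpair; [apply: (rec_comp2 PP)|];
    do !(apply: rec_cfst || apply: rec_csnd || apply: rec_id).
exact: rec_succ1 rec_id.
Qed.

End StrongRecursion.

Ltac rec_tac :=
  lazymatch goal with
  | |- recursive1 (fun x => x) => exact: rec_id
  | |- recursive1 cfst => exact: rec_cfst1
  | |- recursive1 csnd => exact: rec_csnd rec_id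
  | |- recursive1 (fun _ => ?c) => exact: rec_const c
  | |- recursive1 (fun x => S (@?f x)) => apply: (@rec_succ1 f); rec_tac
  | |- recursive1 (fun x => addn (@?f x) (@?g x)) => apply: (@rec_add f g); rec_tac
  | |- recursive1 (fun x => subn (@?f x) (@?g x)) => apply: (@rec_sub f g); rec_tac
  | |- recursive1 (fun x => cpair (@?f x) (@?g x)) => apply: (@rec_cpair f g); rec_tac
  | |- recursive1 (fun x => cnth (@?f x) (@?g x)) => apply: (@rec_cnth f g); rec_tac
  | |- recursive1 (fun x => cfst (@?f x)) => apply: (@rec_cfst f); rec_tac
  | |- recursive1 (fun x => csnd (@?f x)) => apply: (@rec_csnd f); rec_tac
  | |- recursive1 (fun x => nat_of_bool (leq (@?f x) (@?g x))) =>
      apply: (@rec_leq f g); rec_tac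
  | |- recursive1 (fun x => nat_of_bool (@eq_op _ (@?f x) (@?g x))) =>
      apply: (@rec_eq f g); rec_tac
  | |- recursive1 (fun x => nat_of_bool (negb (@?f x))) => apply: (@rec_not f); rec_tac
  | |- recursive1 (fun x => nat_of_bool (andb (@?f x) (@?g x))) =>
      apply: (@rec_and f g); rec_tac
  | |- recursive1 (fun x => nat_of_bool (orb (@?f x) (@?g x))) =>
      apply: (@rec_or f g); rec_tac
  | |- recursive1 (fun x => nat_of_bool (if _ then _ else _)) =>
      apply: rec_ifb; rec_tac
  | |- recursive1 (fun x => if _ then _ else _) =>
      apply: rec_if; rec_tac
  | |- recursive1 (fun x => nat_of_bool (exb (@?n x) (@?P x))) =>
      apply: (@rec_exb P n); cbv beta; rec_tac
  | |- recursive1 (fun x => nat_of_bool (allb (@?n x) (@?P x))) =>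
      apply: (@rec_allb P n); cbv beta; rec_tac
  | |- recursive1 (fun x => ?g (@?f x)) =>
      try (apply: (@rec_comp1 g f); [try assumption | rec_tac])
  | _ => try assumption
  end.

Opaque cpair cfst csnd strong strong_table.

(** * Decoding of terms *)

Lemma ltn_csnd n : cfst n != 0 -> csnd n < n.
Proof. by rewrite -[X in _ < X]cpair_fst_snd -lt0n; apply: ltn_cpair_r. Qed.

Local Notation arg1 n := (cfst (csnd n)).
Local Notation arg2 n := (csnd (csnd n)).

Lemma ltn_arg1 n : cfst n != 0 -> arg1 n < n.
Proof. by move/ltn_csnd; apply: leq_ltn_trans; apply: leq_cfst. Qed.

Lemma ltn_arg2 n : cfst n != 0 -> arg2 n < n.
Proof. by move/ltn_csnd; apply: leq_ltn_trans; apply: leq_csnd. Qed.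

Lemma cpair_csnd k n : cfst n = k -> cpair k (csnd n) = n.
Proof. by move<-; apply: cpair_fst_snd. Qed.

Lemma cpair_args k n : cfst n = k -> cpair k (cpair (arg1 n) (arg2 n)) = n.
Proof. by move<-; rewrite !cpair_fst_snd. Qed.

(** Tag 0 needs no further check because the numbering of primitive tests is onto, while a constant
    must carry the payload 0. The index [n - (arg1 n).+1] looks up the earlier value at [arg1 n] in
    the history [s]. *)
Definition test_body n (s : nat) : nat :=
  if cfst n == 0 then 1 else
  if (cfst n == 2) || (cfst n == 3) then nat_of_bool (csnd n == 0) else
  if (cfst n == 4) || (cfst n == 5) then
    nat_of_bool ((cnth s (n - (arg1 n).+1) != 0) && (cnth s (n - (arg2 n).+1) != 0))
  else 0.

Definition testc n := strong test_body n != 0.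

Lemma rec_testc : recursive1 (fun n => testc n).
Proof.
have h : recursive1 (strong test_body).
  by apply/rec_strong/recursive2_curry; rewrite /test_body; rec_tac.
rewrite /testc; rec_tac.
Qed.

Lemma testcE n : testc n =
  if cfst n == 0 then true else
  if (cfst n == 2) || (cfst n == 3) then csnd n == 0 else
  if (cfst n == 4) || (cfst n == 5) then testc (arg1 n) && testc (arg2 n)
  else false.
Proof.
rewrite [in LHS]/testc strongE {1}/test_body; case: ifPn => // n0.
case: ifP => _; first by rewrite eqb0 negbK.
case: ifP => // _; rewrite !strong_tableE ?ltn_arg1 ?ltn_arg2 // -/(testc _) -/(testc _).
by rewrite eqb0 negbK.
Qed.

Section Codes.
Variables (P A : Type) (tilde : P -> P) (codeP : P -> nat) (codeA : A -> nat).
Hypotheses (codeP_bij : bijective codeP) (codeA_bij : bijective codeA).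
Variable tildec : nat -> nat.
Hypotheses (rec_tildec : recursive1 tildec)
  (tildecP : forall p, codeP (tilde p) = tildec (codeP p)).

Notation code := (code codeP codeA).

Lemma code_inj : injective code.
Proof.
elim=> [[p|a]|||t IHt u IHu|t IHt u IHu|t IHt u IHu|t IHt] [[p'|a']|||t' u'|t' u'|t' u'|t'] //=
  /cpair_inj[] //.
- by move=> _ /(bij_inj codeP_bij)->.
- by move=> _ /(bij_inj codeA_bij)->.
- by move=> _ /cpair_inj[/IHt-> /IHu->].
- by move=> _ /cpair_inj[/IHt-> /IHu->].
- by move=> _ /cpair_inj[/IHt-> /IHu->].
- by move=> _ /IHt->.
Qed.

Lemma testcP n : testc n <-> exists2 t : term P A, code t = n & test t.
Proof.
split; last first.
  case=> t <-; elim=> [p|||b c _ IHb _ IHc|b c _ IHb _ IHc]; rewrite testcE /= !cpairE //=.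
  - by rewrite IHb IHc.
  - by rewrite IHb IHc.
have [n1 lt] := ubnP n; elim: n1 n lt => // n1 IH n lt.
rewrite testcE.
have [e _|n0] := eqVneq (cfst n) 0.
  have [k _ kK] := codeP_bij; exists (prim (k (csnd n))); last exact: test_prim.
  by rewrite /= kK (cpair_csnd e).
have [e|_] := eqVneq (cfst n) 2.
  by move/eqP=> e1; exists One; [rewrite /= -e -e1 cpair_fst_snd|exact: test_one].
have [e|_] := eqVneq (cfst n) 3.
  by move/eqP=> e1; exists Zero; [rewrite /= -e -e1 cpair_fst_snd|exact: test_zero].
have l1 := leq_trans (ltn_arg1 n0) lt; have l2 := leq_trans (ltn_arg2 n0) lt.
have [e|_] := eqVneq (cfst n) 4.
  case/andP=> /(IH _ l1)[t te tP] /(IH _ l2)[u ue uP].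
  exists (Seq t u); last exact: test_seq.
  by rewrite /= te ue (cpair_args e).
have [e|//] := eqVneq (cfst n) 5.
case/andP=> /(IH _ l1)[t te tP] /(IH _ l2)[u ue uP].
exists (Plus t u); last exact: test_plus.
by rewrite /= te ue (cpair_args e).
Qed.

Definition compl_body n (s : nat) : nat :=
  if cfst n == 0 then cpair 0 (tildec (csnd n)) else
  if n == cpair 2 0 then cpair 3 0 else
  if n == cpair 3 0 then cpair 2 0 else
  if cfst n == 4 then
    cpair 5 (cpair (cnth s (n - (arg1 n).+1)) (cnth s (n - (arg2 n).+1)))
  else if cfst n == 5 then
    cpair 4 (cpair (cnth s (n - (arg1 n).+1)) (cnth s (n - (arg2 n).+1)))
  else n.

Definition complc := strong compl_body.

Lemma rec_complc : recursive1 complc.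
Proof. by apply/rec_strong/recursive2_curry; rewrite /compl_body; rec_tac. Qed.

Lemma complcE (t : term P A) : complc (code t) = code (compl tilde t).
Proof.
have neq m n m' n' : m != m' -> (cpair m n == cpair m' n') = false.
  by move=> mm; apply/eqP => /cpair_inj[e]; rewrite e eqxx in mm.
elim: t => [[p|a]|||t IHt u IHu|t IHt u IHu|t IHt u IHu|t IHt];
  rewrite /complc strongE {1}/compl_body ![Defs.code _ _ _]/= ?cpairE ?eqxx ?neq //= ?tildecP //.
all: have lt1 k b : code t < cpair k.+1 (cpair (code t) b).
all: try by apply: leq_ltn_trans (leq_cpair_l _ _) (ltn_cpair_r _ _).
all: have lt2 k a : code u < cpair k.+1 (cpair a (code u)).
all: try by apply: leq_ltn_trans (leq_cpair_r _ _) (ltn_cpair_r _ _).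
all: by rewrite !strong_tableE ?lt1 ?lt2 // -/(complc _) -/(complc _) IHt IHu.
Qed.

(** Guarded choice and while are not constructors of terms, so they are recognised by their shape,
    the second guard being compared with the computed complement of the first. A number with tag 4
    may be a composition or a while, whose [Star] is not acceptable by itself. *)
Definition pwp_body n (s : nat) : nat :=
  if testc n || (cfst n == 1) then 1 else
  if cfst n == 4 then nat_of_bool (
    ((cnth s (n - (arg1 n).+1) != 0) && (cnth s (n - (arg2 n).+1) != 0)) ||
    [&& cfst (arg1 n) == 7, cfst (csnd (arg1 n)) == 4, testc (arg1 (csnd (arg1 n))),
        (cnth s (n - (arg2 (csnd (arg1 n))).+1) != 0)
       & arg2 n == complc (arg1 (csnd (arg1 n)))])
  else if cfst n == 5 then nat_of_bool
    [&& cfst (arg1 n) == 4, cfst (arg2 n) == 4, testc (arg1 (arg1 n)),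
        arg1 (arg2 n) == complc (arg1 (arg1 n)),
        (cnth s (n - (arg2 (arg1 n)).+1) != 0) & (cnth s (n - (arg2 (arg2 n)).+1) != 0)]
  else if cfst n == 6 then nat_of_bool ((cnth s (n - (arg1 n).+1) != 0) && (arg2 n == cpair 2 0))
  else 0.

Definition pwpc n := strong pwp_body n != 0.

Lemma rec_pwpc : recursive1 (fun n => pwpc n).
Proof.
have h1 := rec_complc; have h2 := rec_testc.
have h : recursive1 (strong pwp_body).
  apply/rec_strong/recursive2_curry; rewrite /pwp_body.
  by rec_tac; apply: (rec_comp1 (f := fun n => nat_of_bool (testc n)) h2); rec_tac.
rewrite /pwpc; rec_tac.
Qed.

Lemma pwpcE n : pwpc n =
  if testc n || (cfst n == 1) then true else
  if cfst n == 4 then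
    (pwpc (arg1 n) && pwpc (arg2 n)) ||
    [&& cfst (arg1 n) == 7, cfst (csnd (arg1 n)) == 4, testc (arg1 (csnd (arg1 n))),
        pwpc (arg2 (csnd (arg1 n)))
       & arg2 n == complc (arg1 (csnd (arg1 n)))]
  else if cfst n == 5 then
    [&& cfst (arg1 n) == 4, cfst (arg2 n) == 4, testc (arg1 (arg1 n)),
        arg1 (arg2 n) == complc (arg1 (arg1 n)),
        pwpc (arg2 (arg1 n)) & pwpc (arg2 (arg2 n))]
  else if cfst n == 6 then pwpc (arg1 n) && (arg2 n == cpair 2 0)
  else false.
Proof.
rewrite [in LHS]/pwpc strongE {1}/pwp_body; case: ifPn => //.
rewrite negb_or => /andP[nt n1].
have [n0|n0] := eqVneq (cfst n) 0; first by rewrite testcE n0 in nt.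
have l1 := ltn_arg1 n0; have l2 := ltn_arg2 n0.
(* The shapes of [while] and [ite] recurse on subterms several levels down; these too must be
   smaller than [n] to be found in the history. *)
have lc m : m <= arg1 n -> arg2 m < n.
  by move=> h; apply: leq_ltn_trans l1; apply: leq_trans h;
    apply: leq_trans (leq_csnd _) (leq_csnd _).
have lc' m : m <= arg2 n -> arg2 m < n.
  by move=> h; apply: leq_ltn_trans l2; apply: leq_trans h;
    apply: leq_trans (leq_csnd _) (leq_csnd _).
have look i : i < n -> (cnth (strong_table pwp_body n) (n - i.+1) != 0) = pwpc i.
  by move=> lt; rewrite strong_tableE.
have [a1 a2 a3] := And3 (lc _ (leq_csnd _)) (lc _ (leqnn _)) (lc' _ (leqnn _)).
rewrite !look //.
by do 3?[case: ifP => _; first by rewrite eqb0 negbK].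
Qed.

Lemma pwpcP n : pwpc n <-> exists2 t : term P A, code t = n & pwp tilde t.
Proof.
split; last first.
  have testT (b : term P A) : test b -> testc (code b).
    by move=> bP; apply/testcP; exists b.
  case=> t <-; elim=> [b|a|t' u _ IHt _ IHu|b t' u bP _ IHt _ IHu|b t' bP _ IHt|t' _ IHt];
    rewrite pwpcE.
  - by move/testT->.
  - by rewrite /= !cpairE orbT.
  - by case: ifP => // _; rewrite /= !cpairE /= IHt IHu.
  - by case: ifP => // _; rewrite /= !cpairE /= testT // complcE eqxx IHt IHu.
  - by case: ifP => // _; rewrite /= !cpairE /= testT // complcE eqxx IHt orbT.
  - by case: ifP => // _; rewrite /= !cpairE /= IHt eqxx.
have [n1 lt] := ubnP n; elim: n1 n lt => // n1 IH n lt.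
rewrite pwpcE.
have [/testcP[t te tP] _|nt] := boolP (testc n).
  by exists t => //; apply: pwp_test.
have {nt}n0 : cfst n != 0 by apply: contra nt => n0; rewrite testcE n0.
have l1 := leq_trans (ltn_arg1 n0) lt; have l2 := leq_trans (ltn_arg2 n0) lt.
have lc m : m <= arg1 n -> arg2 m < n1.
  by move=> h; apply: leq_ltn_trans l1; apply: leq_trans h;
    apply: leq_trans (leq_csnd _) (leq_csnd _).
have lc' m : m <= arg2 n -> arg2 m < n1.
  by move=> h; apply: leq_ltn_trans l2; apply: leq_trans h;
    apply: leq_trans (leq_csnd _) (leq_csnd _).
have [e _|_] := eqVneq (cfst n) 1.
  have [k _ kK] := codeA_bij; exists (act (k (csnd n))); last exact: pwp_act.
  by rewrite /= kK (cpair_csnd e).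
have [e|_] := eqVneq (cfst n) 4.
  case/orP=> [/andP[/(IH _ l1)[t te tP] /(IH _ l2)[u ue uP]]|].
    exists (Seq t u); last exact: pwp_seq.
    by rewrite /= te ue (cpair_args e).
  case/and5P => /eqP e1 /eqP e2 /testcP[b be bP] /(IH _ (lc _ (leq_csnd _)))[t te tP] /eqP e3.
  exists (while tilde b t); last exact: pwp_while.
  by rewrite /= -complcE te be -e3 (cpair_args e2) (cpair_csnd e1) (cpair_args e).
have [e|_] := eqVneq (cfst n) 5.
  case/and5P => /eqP e1 /eqP e2 /testcP[b be bP] /eqP e3.
  move=> /andP[/(IH _ (lc _ (leqnn _)))[t te tP] /(IH _ (lc' _ (leqnn _)))[u ue uP]].
  exists (ite tilde b t u); last exact: pwp_ite.
  by rewrite /= -complcE te be ue -e3 (cpair_args e1) (cpair_args e2) (cpair_args e).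
have [e|//] := eqVneq (cfst n) 6.
case/andP=> /(IH _ l1)[t te tP] /eqP e1.
exists (loop t); last exact: pwp_loop.
by rewrite /= te -e1 (cpair_args e).
Qed.

End Codes.

(** * Certificates of nonemptiness *)

Lemma leq_cnth s i : cnth s i <= s.
Proof.
apply: leq_trans (leq_cfst _) _; elim: i => //= i IH.
exact: leq_trans (leq_csnd _) IH.
Qed.

Section ExtendValuation.
Variables (P A B : Type) (tilde : P -> P) (codeP : P -> nat).
Hypotheses (codeP_inj : injective codeP) (tildeK : involutive tilde)
  (tilde_free : forall p, tilde p <> p).
Variable v : valuation P A B.

(* Where [v] decides neither [p] nor [tilde p], the one of smaller code is made
   true. *)
Definition extend_val : valuation P A B := fun x =>
  match x with
  | inl p => fun a b => a = b /\
      (v (inl p) a a \/ ~ v (inl (tilde p)) a a /\ codeP p < codeP (tilde p))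
  | inr _ => v x
  end.

Hypotheses (B_inh : inhabited B)
  (v_fun : forall a x y z, v (inr a) x y -> v (inr a) x z -> y = z)
  (v_id : forall p x y, v (inl p) x y -> x = y)
  (v_excl : forall p x, v (inl p) x x -> ~ v (inl (tilde p)) x x).

(** As [p] and [tilde p] are distinct, so are their codes, and the tie-break selects exactly one of
    them. It applies only where [v] is silent, so a clash could come only from [v] itself, which
    [v_excl] forbids. *)
Lemma extend_val_drel : drel_test tilde extend_val.
Proof.
split=> // [[p|a] x y z|p x y|p x y] /=.
- by move=> [<- _] [<- _].
- exact: v_fun.
- by case.
rewrite tildeK; split=> -[<- h]; split=> //.
  by case: h => [h|[h lt]] [_ [h'|[h' lt']]] //; [exact: v_excl h' h | lia].
have [h1|h1] := pselect (v (inl (tilde p)) x x); first by left.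
have [h2|h2] := pselect (v (inl p) x x); first by case: h; split; [|left].
right; split=> //; rewrite ltnNge leq_eqVlt; apply/negP => /orP[/eqP/codeP_inj|lt].
  by move/esym/tilde_free.
by apply: h; split; [|right].
Qed.

Lemma extend_val_sub x a b : v x a b -> extend_val x a b.
Proof. by case: x => [p|//] /= h; have ab := v_id h; subst b; split; [|left]. Qed.

End ExtendValuation.

(* A certificate lists the facts [eval v t a b] of a derivation, each coded as
   [cpair (code t) (cpair a b)] and justified by later ones. *)
Definition base_fact f :=
  let c := cfst f in
  [|| cfst c <= 1, (cfst c == 2) && (arg1 f == arg2 f)
    | (cfst c == 7) && (arg1 f == arg2 f)].

(** The intermediate point of a composition or of an iteration is read off as [arg2 g]. A union has
    a single premise, which may be repeated as [h]. *)
Definition step_fact f g h :=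
  let c := cfst f in
  [|| [&& cfst c == 4, g == cpair (arg1 c) (cpair (arg1 f) (arg2 g))
        & h == cpair (arg2 c) (cpair (arg2 g) (arg2 f))],
      (cfst c == 5) && ((g == cpair (arg1 c) (csnd f)) || (g == cpair (arg2 c) (csnd f))),
      [&& cfst c == 6, g == cpair (arg1 c) (csnd f) & h == cpair (arg2 c) (csnd f)]
    | [&& cfst c == 7, g == cpair (csnd c) (cpair (arg1 f) (arg2 g))
        & h == cpair c (cpair (arg2 g) (arg2 f))]].

Section Certificates.
Variables (P A : Type) (tilde : P -> P) (codeP : P -> nat) (codeA : A -> nat).
Hypotheses (codeP_bij : bijective codeP) (codeA_bij : bijective codeA)
  (tildeK : involutive tilde) (tilde_free : forall p, tilde p <> p).
Variable tildec : nat -> nat.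
Hypotheses (rec_tildec : recursive1 tildec)
  (tildecP : forall p, codeP (tilde p) = tildec (codeP p)).

Notation code := (code codeP codeA).

(** Only facts about variables can conflict: an action with two targets, a primitive test off the
    diagonal, or two complementary tests at one point. A test may stay undecided, since [extend_val]
    completes the valuation afterwards. *)
Definition compat_facts f g :=
  ~~ ([&& cfst (cfst f) == 1, cfst g == cfst f, arg1 g == arg1 f & arg2 g != arg2 f]
  || (cfst (cfst f) == 0) && ((arg1 f != arg2 f) ||
       (cfst g == cpair 0 (tildec (csnd (cfst f)))) && (arg1 g == arg1 f))).

Definition cert n y :=
  let m := cfst y in let F i := cnth (csnd y) i in
  [&& exb m (fun i => cfst (F i) == n),
      allb m (fun i => base_fact (F i) ||
        exb m (fun j => exb m (fun k => [&& i < j, i < k & step_fact (F i) (F j) (F k)])))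
    & allb m (fun i => allb m (fun j => compat_facts (F i) (F j)))].

Lemma recursive_cert : recursive_rel (fun n y => pwpc tildec n && ~~ cert n y).
Proof.
apply: (@recursive2_curry (fun n y => pwpc tildec n && ~~ cert n y)).
have h1 := rec_comp1 (rec_pwpc rec_tildec) rec_cfst1.
rewrite /cert /base_fact /step_fact /compat_facts; cbv zeta beta.
by rec_tac.
Qed.

Lemma cert_finite_model (t : term P A) y : cert (code t) y ->
  exists (B : Type) (v : valuation P A B),
    drel_test_fin tilde v /\ exists a b, eval v t a b.
Proof.
rewrite /cert; set m := cfst y; set F := fun i => cnth (csnd y) i.
case/and3P=> /exbP[i0 i0m /eqP i0t] /allbP justF /allbP compF.
(* Every point named in the certificate is a component of the number [y], hence at most [y]. *)
pose B := 'I_y.+1.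
pose w : valuation P A B := fun x a b =>
  exists2 i, i < m & F i = cpair (code (Var x)) (cpair a b).
have wP x a b : w x a b -> exists i, [/\ i < m, cfst (F i) = code (Var x),
    arg1 (F i) = a & arg2 (F i) = b].
  by case=> i im Fi; exists i; rewrite Fi !cpairE.
have wfun a x x1 x2 : w (inr a) x x1 -> w (inr a) x x2 -> x1 = x2.
  move=> /wP[i [im ci ai bi]] /wP[j [jm cj aj bj]].
  have /allbP/(_ j jm) := compF i im.
  rewrite /compat_facts ci cj ai aj bi bj /= !cpairE !eqxx /= orbF negbK.
  by move/eqP => e; apply/val_inj.
have wid p x x' : w (inl p) x x' -> x = x'.
  move=> /wP[i [im ci ai bi]]; have /allbP/(_ i im) := compF i im.
  rewrite /compat_facts ci ai bi /= !cpairE /=; case: eqP => //= e _.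
  exact: val_inj.
have wexcl p x : w (inl p) x x -> ~ w (inl (tilde p)) x x.
  move=> /wP[i [im ci ai bi]] /wP[j [jm cj aj bj]].
  have /allbP/(_ j jm) := compF i im.
  by rewrite /compat_facts ci cj ai aj bi bj /= !cpairE /= tildecP !eqxx.
pose v := extend_val tilde codeP w.
have vP : drel_test tilde v.
  have Binh : inhabited B by exact: (inhabits ord0).
  apply (extend_val_drel (bij_inj codeP_bij) tildeK tilde_free Binh wfun wexcl).
exists B, v; split; first by split=> [//|]; exact: finite_finset.
suff main i u : i < m -> cfst (F i) = code u ->
    eval v u (inord (arg1 (F i))) (inord (arg2 (F i))).
  by exists (inord (arg1 (F i0))), (inord (arg2 (F i0))); apply: main.
(* Premises stand later in the list, so the induction is on the distance to its end. *)
have [k lt] := ubnP (m - i); elim: k i u lt => // k IH i u lt im ci.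
have Fy j : F j <= y by apply: leq_trans (leq_cnth _ _) (leq_csnd _).
have ay j : arg1 (F j) < y.+1.
  by apply: leq_ltn_trans (leq_cfst _) _; apply: leq_trans (leq_csnd _) (Fy _).
have ayb j : arg2 (F j) < y.+1.
  by apply: leq_ltn_trans (leq_csnd _) _; apply: leq_trans (leq_csnd _) (Fy _).
have IHj j t' : i < j -> j < m -> cfst (F j) = code t' ->
    eval v t' (inord (arg1 (F j))) (inord (arg2 (F j))).
  by move=> ij jm; apply: IH => //; lia.
have := justF i im; rewrite /base_fact /step_fact ci.
case: u ci => [x|||t1 t2|t1 t2|t1 t2|t1] ci; rewrite [Defs.code _ _ _]/= ?cpairE /=.
- move=> _; apply: extend_val_sub => //.
  by exists i; rewrite // !inordK // cpair_args.
- rewrite orbF; case: eqP => [-> //|_ /exbP[j _ /exbP[k' _]]].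
  by rewrite !andbF.
- by move=> /exbP[j _ /exbP[k' _]]; rewrite !andbF.
- move=> /exbP[j jm /exbP[k' km]]; rewrite orbF => /and3P[ij ik /andP[/eqP Fj /eqP Fk]].
  have := IHj j t1 ij jm; have := IHj k' t2 ik km.
  rewrite /F Fj Fk !cpairE => /(_ erefl) h2 /(_ erefl) h1.
  by exists (inord (arg2 (F j))).
- move=> /exbP[j jm /exbP[k' km]]; rewrite orbF => /and3P[ij ik /orP[]/eqP Fj].
    by have := IHj j t1 ij jm; rewrite /F Fj !cpairE => /(_ erefl) h1; left.
  by have := IHj j t2 ij jm; rewrite /F Fj !cpairE => /(_ erefl) h1; right.
- move=> /exbP[j jm /exbP[k' km]]; rewrite orbF => /and3P[ij ik /andP[/eqP Fj /eqP Fk]].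
  have := IHj j t1 ij jm; have := IHj k' t2 ik km.
  by rewrite /F Fj Fk !cpairE => /(_ erefl) h2 /(_ erefl) h1.
- case: eqP => [-> _|_ /=]; first exact: rt_refl.
  move=> /exbP[j jm /exbP[k' km]] /and3P[ij ik /andP[/eqP Fj /eqP Fk]].
  have := IHj j t1 ij jm; have := IHj k' (Star t1) ik km.
  rewrite /F Fj Fk !cpairE => /(_ erefl) h2 /(_ erefl) h1.
  by apply: rt_trans h2; apply: rt_step h1.
Qed.

(** * Finite derivations in an arbitrary structure *)

Section Facts.
Variables (B : Type) (v : valuation P A B).

Definition fact := (term P A * B * B)%type.

Definition justified (f : fact) (L : seq fact) : Prop :=
  let: (t, a, b) := f in
  match t with
  | Var x => v x a b
  | One => a = b
  | Zero => False
  | Seq t u => exists c, List.In (t, a, c) L /\ List.In (u, c, b) L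
  | Plus t u => List.In (t, a, b) L \/ List.In (u, a, b) L
  | Cap t u => List.In (t, a, b) L /\ List.In (u, a, b) L
  | Star u => a = b \/ exists c, List.In (u, a, c) L /\ List.In (t, c, b) L
  end.

Fixpoint derivation (L : seq fact) : Prop :=
  if L is f :: L' then justified f L' /\ derivation L' else True.

Lemma justified_incl f L L' :
  (forall g, List.In g L -> List.In g L') -> justified f L -> justified f L'.
Proof.
case: f => [[[x|||t u|t u|t u|t] a] b] sub //=.
- by case=> c [/sub h1 /sub h2]; exists c.
- by case=> /sub; [left|right].
- by case=> /sub h1 /sub h2.
- by case=> [|[c [/sub h1 /sub h2]]]; [left|right; exists c].
Qed.

Lemma derivation_cat L L' : derivation L -> derivation L' -> derivation (L ++ L').
Proof.
move=> + dL'; elim: L => //= f L IH [jf /IH dL]; split=> //.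
by apply: justified_incl jf => g gL; apply/List.in_or_app; left.
Qed.

Lemma eval_derivation t a b : eval v t a b -> exists L, derivation ((t, a, b) :: L).
Proof.
elim: t a b => [x|||t IHt u IHu|t IHt u IHu|t IHt u IHu|t IHt] a b /=.
- by exists [::].
- by exists [::].
- by [].
- case=> c /IHt[L1 d1] /IHu[L2 d2].
  exists (((t, a, c) :: L1) ++ ((u, c, b) :: L2)); split; last exact: derivation_cat.
  by exists c; split; [left | right; apply/List.in_or_app; right; left].
- case=> [/IHt|/IHu] [L d].
    by exists ((t, a, b) :: L); split => //; left; left.
  by exists ((u, a, b) :: L); split => //; right; left.
- case=> /IHt[L1 d1] /IHu[L2 d2].
  exists (((t, a, b) :: L1) ++ ((u, a, b) :: L2)); split; last exact: derivation_cat.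
  by split; [left | right; apply/List.in_or_app; right; left].
- move/(clos_rt_rt1n _ _ _ _) => h; induction h as [a|a c b h1 _ [L2 d2]].
    by exists [::]; split => //; left.
  have [L1 d1] := IHt _ _ h1.
  exists (((t, a, c) :: L1) ++ ((Star t, c, b) :: L2)); split; last exact: derivation_cat.
  by right; exists c; split; [left | right; apply/List.in_or_app; right; left].
Qed.

Lemma derivation_nth d L i : derivation L -> i < size L ->
  justified (nth d L i) (drop i.+1 L).
Proof.
by elim: L i => //= f L IH [|i] [jf dL]; rewrite ?drop0 //; apply: IH.
Qed.

Lemma In_drop_nth d (L : seq fact) i g : List.In g (drop i L) ->
  exists j, [/\ i <= j, j < size L & nth d L j = g].
Proof.
elim: L i => [|f L IH] [|i] //=; last by case/IH=> j [ij jL gj]; exists j.+1.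
case=> [<-|gL]; first by exists 0.
have [|j [_ jL gj]] := IH 0; first by rewrite drop0.
by exists j.+1.
Qed.

End Facts.

Lemma model_cert (B : Type) (v : valuation P A B) (t : term P A) a b :
  drel_test tilde v -> eval v t a b -> exists y, cert (code t) y.
Proof.
case=> _ vfun vid vtilde ev; have [L0 dL] := eval_derivation ev.
pose d : fact B := (t, a, b); pose L := d :: L0; rewrite -/d -/L in dL.
pose pts := [seq f.1.2 | f <- L] ++ [seq f.2 | f <- L].
(* The carrier is arbitrary, so a point is numbered by its first position in the finite list of
   endpoints occurring in the derivation. This numbering is injective on that list, which is all
   that compatibility requires. *)
pose e (x : B) := find (fun y => `[< y = x >]) pts.
have e_inj x y : List.In x pts -> List.In y pts -> e x = e y -> x = y.
  have nthe z : List.In z pts -> nth a pts (e z) = z.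
    move=> zP; apply/asboolP; apply: (@nth_find _ a (fun y => `[< y = z >])).
    elim: (pts) zP => //= z' s IH [->|/IH ->]; last by rewrite orbT.
    by apply/orP; left; apply/asboolP.
  by move=> /nthe xP /nthe yP exy; rewrite -xP exy yP.
have [in1 in2] : (forall i, i < size L -> List.In (nth d L i).1.2 pts) /\
    (forall i, i < size L -> List.In (nth d L i).2 pts).
  have nthIn i : i < size L -> List.In (nth d L i) L.
    by elim: (L) i => //= f s IH [|i] lt; [left | right; apply: IH].
  split=> i /nthIn iL; rewrite /pts; apply List.in_or_app.
    by left; apply: (List.in_map (fun f : fact B => f.1.2)) iL.
  by right; apply: (List.in_map (fun f : fact B => f.2)) iL.
pose enc (f : fact B) := cpair (code f.1.1) (cpair (e f.1.2) (e f.2)).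
have [s sP] := cnth_ex (fun i => enc (nth d L i)) (size L).
exists (cpair (size L) s); rewrite /cert !cpairE; apply/and3P; split.
- by apply/exbP; exists 0 => //; rewrite sP // cpairE.
- apply/allbP => i iL; rewrite sP //.
  have := derivation_nth d dL iL; set D := drop _ _.
  have DE g : List.In g D -> exists j, [/\ i < j, j < size L & cnth s j = enc g].
    by move/(In_drop_nth d) => [j [ij jL <-]]; exists j; rewrite sP.
  have step g h : List.In g D -> List.In h D ->
      step_fact (enc (nth d L i)) (enc g) (enc h) ->
      exb (size L) (fun j => exb (size L) (fun k => [&& i < j, i < k &
        step_fact (enc (nth d L i)) (cnth s j) (cnth s k)])).
    move=> /DE[j [ij jL <-]] /DE[k [ik kL <-]] st.
    by apply/exbP; exists j => //; apply/exbP; exists k => //; rewrite ij ik.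
  case: (nth d L i) step => [[[[p|q]|||t1 t2|t1 t2|t1 t2|t1] x] y] step /=.
  + by rewrite /base_fact !cpairE.
  + by rewrite /base_fact !cpairE.
  + by move=> ->; rewrite /base_fact !cpairE /= eqxx.
  + by [].
  + case=> c [h1 h2]; apply/orP; right; apply: step h1 h2 _.
    by rewrite /step_fact /enc /= !cpairE /= !eqxx.
  + case=> h1; apply/orP; right; apply: (step _ _ h1 h1);
      by rewrite /step_fact /enc /= !cpairE /= !eqxx ?orbT.
  + case=> h1 h2; apply/orP; right; apply: step h1 h2 _.
    by rewrite /step_fact /enc /= !cpairE /= !eqxx.
  + case=> [->|[c [h1 h2]]]; first by rewrite /base_fact !cpairE /= eqxx.
    apply/orP; right; apply: step h1 h2 _.
    by rewrite /step_fact /enc /= !cpairE /= !eqxx.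
- apply/allbP => i iL; apply/allbP => j jL; rewrite !sP //.
  have := derivation_nth d dL iL; have := derivation_nth d dL jL.
  have := in1 i iL; have := in1 j jL; have := in2 i iL; have := in2 j jL.
  rewrite /compat_facts /enc.
  case: (nth d L i) => [[t1 x] y]; case: (nth d L j) => [[t2 x'] y'].
  rewrite !cpairE /=; case: t1 => [[p|q]|||t1 u1|t1 u1|t1 u1|t1]; rewrite /= ?cpairE //=.
    move=> _ _ x'P xP + vp; have exy := vid _ _ _ vp; rewrite -{y}exy in vp *.
    rewrite eqxx /= -tildecP; case: eqP => //= ct.
    have {ct}-> : t2 = prim (tilde p) by apply: (code_inj codeP_bij codeA_bij).
    move=> /= vtp; apply/eqP => /(e_inj _ _ x'P xP) ex.
    have [exy' nvp] := (vtilde p x' y').1 vtp.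
    by apply: nvp; rewrite -exy' ex.
  move=> y'P yP x'P xP + vq; rewrite orbF.
  case: eqP => //= ct; have {ct}-> : t2 = act q by apply: (code_inj codeP_bij codeA_bij); exact: ct.
  move=> /= vq'; case: eqP => //= /(e_inj _ _ x'P xP) ex; rewrite ex in vq'.
  by rewrite (vfun _ _ _ _ vq vq') eqxx.
Qed.

(** Any structure in [K] yields a certificate, and any certificate yields a finite structure, which
    again lies in [K]. So nonemptiness over [K] amounts to the existence of a certificate. *)
Lemma emptiness_Pi01 (K : forall B : Type, valuation P A B -> Prop) :
  (forall B v, K B v -> drel_test tilde v) ->
  (forall B v, drel_test_fin tilde v -> K B v) ->
  Pi01 (emptiness_problem tilde codeP codeA K).
Proof.
move=> Kdrel finK; exists (fun n y => pwpc tildec n && ~~ cert n y).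
  exact: recursive_cert.
have pP := pwpcP codeP_bij codeA_bij tildecP.
move=> n; split=> [[t [<- tP tE]] y|h].
  apply/andP; split; first by apply/pP; exists t.
  apply/negP => /cert_finite_model[B [v [vfin [a [b ab]]]]].
  exact: tE (finK _ _ vfin) a b ab.
(* The conjunct [pwpc] excludes numbers that code no PWP term; any single instance of [h] therefore
   supplies the term. *)
have /andP[/pP[t tn tP] _] := h 0; subst n; exists t; split=> // B v vK a b ab.
have [y yP] := model_cert (Kdrel _ _ vK) ab.
by have /andP[_] := h y; rewrite yP.
Qed.

End Certificates.

(** * Counter programs *)

Inductive cmd :=
| Skip
| Inc of nat
| Dec of nat
| Comp of cmd & cmd
| Loop of nat & cmd.

Definition state := nat -> nat.

Definition upd (s : state) i x : state := fun j => if j == i then x else s j.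

(* [exec p s h]: from state [s], the command [p] terminates after passing
   through the states [h]; [Loop i p] runs [p] while register [i] is not 0. *)
Inductive exec : cmd -> state -> seq state -> Prop :=
| exec_skip s : exec Skip s [::]
| exec_inc i s : exec (Inc i) s [:: upd s i (s i).+1]
| exec_dec i s : exec (Dec i) s [:: upd s i (s i).-1]
| exec_comp p q s h h' :
    exec p s h -> exec q (last s h) h' -> exec (Comp p q) s (h ++ h')
| exec_exit i p s : s i = 0 -> exec (Loop i p) s [::]
| exec_loop i p s h h' : s i <> 0 ->
    exec p s h -> exec (Loop i p) (last s h) h' -> exec (Loop i p) s (h ++ h').

Lemma exec_inj p s h h' : exec p s h -> exec p s h' -> h = h'.
Proof.
move=> e; elim: e h' => {p s h}
  [s|i s|i s|p q s h k _ IHh _ IHk|i p s si|i p s h k si _ IHh _ IHk] h' e.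
1,2,3: by inversion e.
- inversion e as [| | |p' q' s' h1 h2 e1 e2| |]; subst.
  by rewrite -(IHh _ e1) in e2 *; rewrite -(IHk _ e2).
- by inversion e.
- inversion e as [| | | |i' p' s' si'|i' p' s' h1 h2 si' e1 e2]; subst => //.
  by rewrite -(IHh _ e1) in e2 *; rewrite -(IHk _ e2).
Qed.

Definition run p s s' := exists2 h, exec p s h & last s h = s'.

Lemma run_inj p s s1 s2 : run p s s1 -> run p s s2 -> s1 = s2.
Proof. by move=> [h1 e1 <-] [h2 e2 <-]; rewrite (exec_inj e1 e2). Qed.

Lemma run_comp p q s s1 s2 : run p s s1 -> run q s1 s2 -> run (Comp p q) s s2.
Proof.
move=> [h1 e1 <-] [h2 e2 <-]; exists (h1 ++ h2); last by rewrite last_cat.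
exact: exec_comp.
Qed.

Lemma run_compE p q s s2 : run (Comp p q) s s2 -> exists2 s1, run p s s1 & run q s1 s2.
Proof.
case=> h e <-; inversion e as [| | |p' q' s' h1 h2 e1 e2| |]; subst.
by exists (last s h1); [exists h1 | exists h2 => //; rewrite last_cat].
Qed.

Lemma run_inc i s : run (Inc i) s (upd s i (s i).+1).
Proof. by eexists; [exact: exec_inc|]. Qed.

Lemma run_dec i s : run (Dec i) s (upd s i (s i).-1).
Proof. by eexists; [exact: exec_dec|]. Qed.

Lemma run_exit i p s : s i = 0 -> run (Loop i p) s s.
Proof. by exists [::] => //; apply: exec_exit. Qed.

Lemma run_step i p s s1 s2 :
  s i <> 0 -> run p s s1 -> run (Loop i p) s1 s2 -> run (Loop i p) s s2.
Proof.
move=> si [h1 e1 <-] [h2 e2 <-]; exists (h1 ++ h2); last by rewrite last_cat.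
exact: exec_loop.
Qed.

(** A total-correctness rule: the index of the invariant is the number of iterations still to be
    made. *)
Lemma run_loop i p (I : nat -> state -> Prop) :
  (forall s, I 0 s -> s i = 0) ->
  (forall m s, I m.+1 s -> s i <> 0 /\ exists2 s', run p s s' & I m s') ->
  forall m s, I m s -> exists2 s', run (Loop i p) s s' & I 0 s'.
Proof.
move=> I0 IS; elim=> [|m IH] s Is; first by exists s => //; apply: run_exit (I0 _ Is).
have [si [s1 r1 /IH[s2 r2 Is2]]] := IS _ _ Is.
by exists s2 => //; apply: run_step r1 r2.
Qed.

Definition clear i := Loop i (Dec i).

Lemma run_clear i s : exists2 s', run (clear i) s s' &
  s' i = 0 /\ forall j, j != i -> s' j = s j.
Proof.
apply: (@run_loop i _ (fun m s' => s' i = m /\ forall j, j != i -> s' j = s j) _ _ (s i)) => //.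
  by move=> s1 [].
move=> m s1 [si sj]; split; first by rewrite si.
eexists; first exact: run_dec.
rewrite /upd eqxx si; split=> // j ji; rewrite (negPf ji); exact: sj.
Qed.

(** Reading a register destroys it, so [i] is first drained into [t], and [t] is then poured back
    into both [i] and [o]. *)
Definition copy i o t :=
  Comp (clear o) (Comp (clear t)
    (Comp (Loop i (Comp (Dec i) (Inc t))) (Loop t (Comp (Dec t) (Comp (Inc i) (Inc o)))))).

Lemma run_copy i o t s : i != o -> t != i -> t != o ->
  exists2 s', run (copy i o t) s s' &
    s' o = s i /\ forall j, j != o -> j != t -> s' j = s j.
Proof.
move=> io ti to; have [s1 r1 [o1 e1]] := run_clear o s.
have [s2 r2 [t2 e2]] := run_clear t s1.
have [|||s3 r3 [i3 t3 e3]] := @run_loop i (Comp (Dec i) (Inc t)) (fun m s' =>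
  [/\ s' i = m, s' t + m = s i & forall j, j != i -> j != t -> s' j = s2 j])
  _ _ (s i) s2.
- by move=> s3 [].
- move=> m s3 [si st sj]; split; first by rewrite si.
  eexists; first exact: run_comp (run_dec _ _) (run_inc _ _).
  rewrite /upd !eqxx (negPf ti) eq_sym (negPf ti) si; split=> //; first by lia.
  by move=> j /[dup] ji /negPf-> /[dup] jt /negPf->; apply: sj.
- by rewrite t2 e2 1?eq_sym // e1.
have [|||s4 r4 [t4 i4 o4 e4]] := @run_loop t (Comp (Dec t) (Comp (Inc i) (Inc o)))
  (fun m s' => [/\ s' t = m, s' i + m = s i, s' o + m = s i &
     forall j, j != i -> j != t -> j != o -> s' j = s2 j]) _ _ (s i) s3.
- by move=> s4 [].
- move=> m s4 [st si so sj]; split; first by rewrite st.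
  eexists; first exact: run_comp (run_dec _ _) (run_comp (run_inc _ _) (run_inc _ _)).
  rewrite /upd !eqxx (negPf ti) (negPf to) (negPf io) [o == i]eq_sym (negPf io).
  rewrite ![_ == t]eq_sym (negPf ti) (negPf to) st; split=> //; try by lia.
  by move=> j /[dup] ji /negPf-> /[dup] jt /negPf-> /[dup] jo /negPf->; apply: sj.
- rewrite i3 addn0 in t3 *; split=> // [|j ji jt _]; last exact: e3.
  by rewrite e3 1?eq_sym // e2 1?eq_sym // o1.
exists s4; first exact: run_comp r1 (run_comp r2 (run_comp r3 r4)).
split; first by lia.
move=> j jo jt; have [->|ji] := eqVneq j i; first by lia.
by rewrite e4 // e2 // e1.
Qed.

(* Registers below [b] other than the output [o] are preserved; those from [b]
   on are scratch. *)
Definition compilable n (f : n.-tuple nat -> nat) := forall (r : n.-tuple nat) o b,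
  (forall j, j \in r -> j < b) -> o < b -> o \notin r ->
  exists p, forall s, exists2 s', run p s s' &
    s' o = f (map_tuple s r) /\ forall j, j < b -> j != o -> s' j = s j.

Lemma eq_map_tuple n (r : n.-tuple nat) (s s' : state) :
  (forall j, j \in r -> s j = s' j) -> map_tuple s r = map_tuple s' r.
Proof. by move=> e; apply/val_inj/eq_in_map. Qed.

Lemma recursive_compilable n (f : n.-tuple nat -> nat) : recursive f -> compilable f.
Proof.
elim=> {n f} [n||n i|m n h g _ IHh _ IHg|n f h g _ IHf _ IHh gf gh|n f g _ IHf g0 gmin]
  r o b rb ob or.
- exists (clear o) => s; have [s' r' [e1 e2]] := run_clear o s.
  by exists s' => //; split=> // j _; apply: e2.
- exists (Comp (copy (thead r) o b) (Inc o)) => s.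
  have tr : thead r \in r by apply: mem_tnth.
  have [|||s' r' [e1 e2]] := @run_copy (thead r) o b s.
  + by apply: contraNneq or => <-.
  + by have := rb _ tr; lia.
  + by lia.
  eexists; first exact: run_comp r' (run_inc _ _).
  rewrite /upd eqxx e1; split; first by rewrite /thead tnth_map.
  by move=> j jb /[dup] jo /negPf->; apply: e2 => //; lia.
- exists (copy (tnth r i) o b) => s.
  have tr : tnth r i \in r by apply: mem_tnth.
  have [|||s' r' [e1 e2]] := @run_copy (tnth r i) o b s.
  + by apply: contraNneq or => <-.
  + by have := rb _ tr; lia.
  + by lia.
  by exists s' => //; split=> [|j jb jo]; [rewrite e1 tnth_map | apply: e2 => //; lia].
(* The inner values go one by one into the registers from [b] to [b + m - 1]. Scratch space starts
   at [b + m] for each of them, so that values already computed survive. *)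
- have gs k : k <= m -> exists p, forall s, exists2 s', run p s s' &
      (forall i : 'I_m, i < k -> s' (b + i) = g i (map_tuple s r)) /\
      forall j, j < b -> s' j = s j.
    elim: k => [_|k IH km].
      by exists Skip => s; exists s => //; exists [::] => //; apply: exec_skip.
    have [p pP] := IH (ltnW km); pose i := Ordinal km.
    have [||| q qP] := IHg i r (b + i) (b + m).
    + by move=> j /rb; lia.
    + by rewrite ltn_add2l.
    + by apply/negP => /rb; lia.
    exists (Comp p q) => s; have [s1 r1 [e1 e1']] := pP s; have [s2 r2 [e2 e2']] := qP s1.
    exists s2; first exact: run_comp r1 r2.
    split=> [i' |j jb]; last by rewrite e2' ?e1' //; lia.
    rewrite ltnS leq_eqVlt => /orP[/eqP ik|ik].
      have -> : i' = i by apply: val_inj.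
      rewrite e2; congr (g i _); apply: eq_map_tuple => j /rb; exact: e1'.
    rewrite e2' ?ltn_add2l // ?e1 // eqn_add2l.
    by apply: contraTneq ik => ->; rewrite ltnn.
  have [p pP] := gs m (leqnn m).
  have [||| q qP] := IHh [tuple b + i | i < m] o (b + m).
  + by move=> j /mapP[i _ ->]; rewrite ltn_add2l.
  + by lia.
  + by apply/mapP => -[i _ oi]; lia.
  exists (Comp p q) => s; have [s1 r1 [e1 e1']] := pP s; have [s2 r2 [e2 e2']] := qP s1.
  exists s2; first exact: run_comp r1 r2.
  split=> [|j jb jo]; last by rewrite e2' ?e1' //; lia.
  rewrite e2; congr h; apply: eq_from_tnth => i.
  by rewrite tnth_map !tnth_mktuple e1.
- move: rb or; case/tupleP: r => r0 r rb or.
  have r0b : r0 < b by apply: rb; rewrite inE eqxx.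
  have rb' j : j \in r -> j < b by move=> jr; apply: rb; rewrite inE jr orbT.
  have [o0 or'] : o != r0 /\ o \notin r by move: or; rewrite inE negb_or => /andP.
  have [||| pf pfP] := IHf r o (b + 3) => //; [by move=> j /rb'; lia | by lia |].
  have [||| ph phP] := IHh [tuple of b.+1 :: o :: r] b.+2 (b + 3).
  + by move=> j; rewrite !inE => /or3P[/eqP->|/eqP->|/rb']; lia.
  + by lia.
  + by rewrite !inE !negb_or; apply/and3P; split; [lia | lia | apply/negP => /rb'; lia].
  (* Register [b] counts the remaining iterations, [b.+1] holds the recursion index, [b.+2] receives
     the value of [h] before it replaces the accumulator in [o], and scratch space starts at
     [b + 3]. *)
  pose body := Comp ph (Comp (copy b.+2 o (b + 3)) (Comp (Inc b.+1) (Dec b))).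
  exists (Comp pf (Comp (clear b.+1) (Comp (copy r0 b b.+2) (Loop b body)))) => s.
  have [s1 r1 [o1 e1]] := pfP s.
  have [s2 r2 [i2 e2]] := run_clear b.+1 s1.
  have [|||s3 r3 [c3 e3]] := @run_copy r0 b b.+2 s2; try by lia.
  set v := map_tuple s r; pose N := s r0.
  have [|||s4 r4 [le4 c4 i4 o4 e4]] := @run_loop b body (fun k s' => [/\ k <= N,
     s' b = k, s' b.+1 = N - k, s' o = g [tuple of (N - k) :: v] &
     forall j, j < b -> j != o -> s' j = s j]) _ _ N s3.
  + by move=> s4 [].
  + move=> k t [le tb ti to te]; split; first by rewrite tb.
    have [t1 q1 [oo1 u1]] := phP t.
    have [|||t2 q2 [oo2 u2]] := @run_copy b.+2 o (b + 3) t1; try by lia.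
    eexists.
      exact: run_comp q1 (run_comp q2 (run_comp (run_inc _ _) (run_dec _ _))).
    have b1 : t2 b.+1 = t b.+1 by rewrite u2 ?u1 //; lia.
    have bb : t2 b = t b by rewrite u2 ?u1 //; lia.
    have [ne1 ne2 ne3 ne4] : [/\ (b == b.+1) = false, (b.+1 == b) = false,
      (o == b) = false & (o == b.+1) = false] by split; apply/negbTE; lia.
    rewrite /upd !eqxx ne1 ne2 ne3 ne4 b1 bb ti tb; split=> //; try by lia.
    * rewrite oo2 oo1 (_ : N - k = (N - k.+1).+1); last by lia.
      rewrite gh; congr h; apply: val_inj => /=.
      rewrite ti to; congr [:: _, _ & _]; apply/eq_in_map => j jr.
      by apply: te; [exact: rb' | apply: contraNneq or' => <-].
    * move=> j jb jo.
      have -> : (j == b) = false by apply/negbTE; lia.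
      have -> : (j == b.+1) = false by apply/negbTE; lia.
      by rewrite u2 ?u1 ?te //; lia.
  + rewrite subnn; split=> //.
    * by rewrite c3 e2 ?e1 //; lia.
    * by rewrite e3 // ?i2 //; lia.
    * by rewrite e3 ?e2 ?o1 ?gf //; lia.
    * by move=> j jb jo; rewrite e3 ?e2 ?e1 //; lia.
  exists s4; first exact: run_comp r1 (run_comp r2 (run_comp r3 r4)).
  split=> //; rewrite o4 subn0; congr g.
  exact: val_inj.
- have [||| pf pfP] := IHf [tuple of o :: r] b b.+1.
  + by move=> j; rewrite inE => /orP[/eqP->|/rb]; lia.
  + by [].
  + by rewrite inE negb_or; apply/andP; split; [lia | apply/negP => /rb; lia].
  (* The output register itself holds the candidate and [b] the value of [f] there. The distance to
     the least zero [g v] bounds the loop. *)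
  exists (Comp (clear o) (Comp pf (Loop b (Comp (Inc o) pf)))) => s.
  have [s1 r1 [o1 e1]] := run_clear o s.
  have [s2 r2 [t2 e2]] := pfP s1.
  set v := map_tuple s r.
  have vE t k : t o = k -> (forall j, j < b -> j != o -> t j = s j) ->
      map_tuple t [tuple of o :: r] = [tuple of k :: v].
    move=> to te; apply: val_inj => /=; rewrite to; congr (_ :: _).
    by apply/eq_in_map => j jr; apply: te; [exact: rb | apply: contraNneq or => <-].
  have [|||s3 r3 [_ o3 _ e3]] := @run_loop b (Comp (Inc o) pf) (fun k s' => [/\ k <= g v,
     s' o = g v - k, s' b = f [tuple of (g v - k) :: v] &
     forall j, j < b -> j != o -> s' j = s j]) _ _ (g v) s2.
  + by move=> t [_ _ -> _]; rewrite subn0 g0.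
  + move=> k t [le to tb te]; split; first by rewrite tb; apply: gmin; lia.
    have [t1 q1 [b1 u1]] := pfP (upd t o (t o).+1).
    exists t1; first exact: run_comp (run_inc _ _) q1.
    have tt : forall j, j < b -> j != o -> upd t o (t o).+1 j = s j.
      by move=> j jb jo; rewrite /upd (negPf jo) te.
    have oo : upd t o (t o).+1 o = g v - k by rewrite /upd eqxx to; lia.
    split; first by lia.
    * by rewrite u1 ?oo //; lia.
    * by rewrite b1 (vE _ _ oo tt).
    * by move=> j jb jo; rewrite u1 ?tt //; lia.
  + rewrite subnn; have e1' j : j < b -> j != o -> s1 j = s j by move=> _; apply: e1.
    split=> //; [by rewrite e2 ?o1 //; lia | by rewrite t2 (vE _ _ o1 e1') |].
    by move=> j jb jo; rewrite e2 ?e1 //; lia.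
  exists s3; first exact: run_comp r1 (run_comp r2 r3).
  by split=> //; rewrite o3 subn0.
Qed.

(** * Simulation of counter programs by terms *)

Local Notation "t ;; u" := (Seq t u) (at level 41, right associativity).

Fixpoint registers_below k (p : cmd) : bool :=
  match p with
  | Skip => true
  | Inc i | Dec i => i < k
  | Comp p q => registers_below k p && registers_below k q
  | Loop i p => (i < k) && registers_below k p
  end.

Lemma nth_cons_cat T (x : T) s t i :
  i <= size t -> nth x (x :: s ++ t) (size s + i) = nth (last x s) (last x s :: t) i.
Proof.
move=> it; rewrite -cat_cons lastI cat_rcons nth_cat size_belast.
by rewrite ltnNge leq_addr addKn; apply: set_nth_default.
Qed.

Section Encoding.
Variables (P A : Type) (tilde : P -> P) (mark : nat -> P) (move : nat -> A).

Notation term := (term P A).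
Notation right := (@act P A (move 0)).
Notation left := (@act P A (move 1)).
Notation up := (@act P A (move 2)).
Notation down := (@act P A (move 3)).
(** [nstart] and [nend] hold away from the first and from the last point of a row, so they serve as
    guards of the walks to the left and to the right. *)
Notation nstart := (mark 0).
Notation nend := (mark 1).
Notation reg i := (mark i.+2).
Notation yes p := (@prim P A p).
Notation no p := (@prim P A (tilde p)).

Definition seqs : seq term -> term := foldr (@Seq P A) One.

(* At [x], with [x'] to its right: the inner loops ensure that the point [e] to
   the left of [b = up x'] satisfies [right e = b] and [up x = e]. *)
Definition grid : term :=
  loop (right ;; up ;; yes nstart ;; loop (left ;; right) ;; left ;; yes nend ;;
        loop (down ;; up) ;; down).

(* The mark of [reg i] at the end of [p1] is to agree with the one at the end of
   [p1 ;; p2]; [p3] leads back. *)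
Definition transfer i (p1 p2 p3 : term) : term :=
  loop (p1 ;; ite tilde (yes (reg i)) (p2 ;; yes (reg i) ;; p3) (p2 ;; no (reg i) ;; p3)).

(** In unary a change by one is a shift by one column: an increment compares [x] with the point
    above its right neighbour, a decrement compares that neighbour with the point above [x]. The
    routes use only moves that [grid] has just checked. *)
Definition check_reg r inc i : term :=
  if i != r then transfer i One up down
  else if inc then transfer i One (right ;; up) (left ;; down)
  else transfer i right (up ;; left) down.

(** The shift of an increment says nothing about the first point of the new row, where the mark has
    to be present. *)
Definition check_head r inc : term :=
  loop (up ;; no nstart ;; (if inc then yes (reg r) else One) ;; down).

Definition zeros k : term := seqs [seq no (reg i) | i <- iota 0 k].

(** The walk makes no comparison from the last point of a row. Requiring the last point above to be
    unmarked settles the marks there, and it leaves no run if an increment would overflow the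
    row. *)
Definition check_last k : term := loop (up ;; no nend ;; zeros k ;; down).

Definition go_back : term := while tilde (yes nstart) left.

Definition update k r inc : term :=
  check_head r inc ;;
  while tilde (yes nend) (grid ;; seqs [seq check_reg r inc i | i <- iota 0 k] ;; right) ;;
  check_last k ;; go_back ;; up.

(** In unary, [reg i] holds at the first point of a row exactly when the counter is not 0, so the
    guard of a loop is tested without any walk. *)
Fixpoint encode k (p : cmd) : term :=
  match p with
  | Skip => One
  | Inc r => update k r true
  | Dec r => update k r false
  | Comp p q => encode k p ;; encode k q
  | Loop i p => while tilde (yes (reg i)) (encode k p)
  end.

(** Checks a first row whose counters are all 0. Its length is wherever the structure lets [nend]
    fail. *)
Definition init k : term :=
  no nstart ;;
  while tilde (yes nend) (zeros k ;; loop (right ;; yes nstart ;; left) ;; right) ;;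
  zeros k ;; go_back.

Lemma pwp_yes p : pwp tilde (yes p).
Proof. by apply/pwp_test/test_prim. Qed.

Lemma pwp_one : pwp tilde (One : term).
Proof. exact/pwp_test/test_one. Qed.

Lemma pwp_seqs (f : nat -> term) l :
  (forall i, pwp tilde (f i)) -> pwp tilde (seqs (map f l)).
Proof.
by move=> fP; elim: l => [|i l IH]; [exact: pwp_one | exact: pwp_seq].
Qed.

Ltac pwp_tac :=
  repeat first [assumption | exact: pwp_yes | exact: pwp_one | exact: test_prim | exact: pwp_act
    | apply: pwp_seqs; assumption | apply: pwp_loop
    | apply: pwp_while | apply: pwp_ite | apply: pwp_seq].

Lemma pwp_zeros k : pwp tilde (zeros k).
Proof. by apply: pwp_seqs => i; pwp_tac. Qed.

Lemma pwp_go_back : pwp tilde go_back.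
Proof. by pwp_tac. Qed.

Lemma pwp_update k r inc : pwp tilde (update k r inc).
Proof.
have H1 := pwp_zeros k; have H2 := pwp_go_back.
have H3 i : pwp tilde (check_reg r inc i).
  by rewrite /check_reg /transfer; case: ifP => _; last case: ifP => _; pwp_tac.
have H4 : pwp tilde (check_head r inc).
  by rewrite /check_head; case: ifP => _; pwp_tac.
by rewrite /update /check_last /grid; pwp_tac.
Qed.

Lemma pwp_encode k p : pwp tilde (encode k p).
Proof.
by elim: p => [|i|i|p IHp q IHq|i p IHp] /=;
  first [exact: pwp_update | pwp_tac].
Qed.

Lemma pwp_init k : pwp tilde (init k).
Proof.
have H1 := pwp_zeros k; have H2 := pwp_go_back.
by rewrite /init; pwp_tac.
Qed.

(** * Meaning of the terms in a given structure, and soundness *)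

Section Semantics.
Variables (B : Type) (v : valuation P A B).
Hypothesis v_drel : drel_test tilde v.

Definition holds p (x : B) := v (inl p) x x.
Definition goes n (x y : B) := v (inr (move n)) x y.

Lemma eval_yes p x y : eval v (yes p) x y <-> x = y /\ holds p x.
Proof.
have [_ _ vid _] := v_drel; split=> [/[dup] /vid <- //|[<-] //].
Qed.

Lemma eval_no p x y : eval v (no p) x y <-> x = y /\ ~ holds p x.
Proof.
have [_ _ _ vtilde] := v_drel; split=> [/vtilde[<-] //|[<- h]].
by apply/vtilde.
Qed.

Lemma goes_inj n x y z : goes n x y -> goes n x z -> y = z.
Proof. by have [_ vfun _ _] := v_drel; apply: vfun. Qed.

Lemma eval_act n x y z : goes n x y -> eval v (act (move n)) x z <-> z = y.
Proof. by move=> xy; split=> [/(goes_inj xy)|->]. Qed.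

Lemma eval_seq t u x y :
  eval v (t ;; u) x y <-> exists2 z, eval v t x z & eval v u z y.
Proof. by []. Qed.

Lemma eval_seqs (f : nat -> term) (Q : nat -> Prop) l x y :
  (forall i z, eval v (f i) x z <-> x = z /\ Q i) ->
  eval v (seqs (map f l)) x y <-> x = y /\ forall i, i \in l -> Q i.
Proof.
move=> fQ; elim: l => [|i l IH]; first by split=> [|[]].
rewrite -[seqs _]/(f i ;; seqs (map f l)).
split=> [[z /fQ[<- Qi] /IH[<- Ql]]|[xy Q']].
  by split=> // j; rewrite inE => /predU1P[->|/Ql].
exists x; first by apply/fQ; split=> //; apply: Q'; rewrite mem_head.
by apply/IH; split=> // j jl; apply: Q'; rewrite inE jl orbT.
Qed.

Lemma eval_zeros k x y :
  eval v (zeros k) x y <-> x = y /\ forall i, i < k -> ~ holds (reg i) x.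
Proof.
rewrite (eval_seqs (Q := fun i => ~ holds (reg i) x)) => [|i z]; last exact: eval_no.
by split=> -[-> h]; split=> // i; move: (h i); rewrite mem_iota.
Qed.

Lemma while_inv (I : B -> Prop) p t x y :
  (forall z z', I z -> holds p z -> eval v t z z' -> I z') ->
  I x -> eval v (while tilde (yes p) t) x y -> I y /\ ~ holds p y.
Proof.
move=> Istep Ix [z /(clos_rt_rt1n _ _ _ _) st /eval_no[<- nz]]; split=> //.
elim: st Ix => // a b c [a' /eval_yes[<- pa] ab] _ IH Ia.
by apply: IH; apply: Istep ab.
Qed.

Lemma while_chain p t (X : nat -> B) n :
  (forall j, j < n -> holds p (X j) /\ eval v t (X j) (X j.+1)) ->
  ~ holds p (X n) -> eval v (while tilde (yes p) t) (X 0) (X n).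
Proof.
move=> Xs Xn; exists (X n); last by apply/eval_no.
have : forall j, j <= n -> clos_refl_trans B (eval v (yes p ;; t)) (X 0) (X j).
  elim=> [_|j IH jn]; first exact: rt_refl.
  apply: rt_trans (IH (ltnW jn)) _; apply: rt_step.
  by have [h1 h2] := Xs j jn; exists (X j) => //; apply/eval_yes.
exact.
Qed.

(** These are the moves travelled by one trip through [grid]. The move left from [x'] to [x] is not
    among them: it belongs to the current row and was checked together with the row before it, or by
    [init]. *)
Record square x x' e b : Prop := Square {
  sq_right : goes 0 x x'; sq_up : goes 2 x e; sq_up' : goes 2 x' b;
  sq_right' : goes 0 e b; sq_left : goes 1 b e; sq_down : goes 3 e x }.

Lemma eval_grid x y : eval v grid x y <->
  x = y /\ exists x' e b, [/\ square x x' e b, holds nstart b & holds nend e].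
Proof.
split.
  case=> -[x1 R1 [b U1 [_ /eval_yes[<- sb] [b1 [[e L1 R2] bb1] [e1 L2]]]]].
  case=> _ /eval_yes[<- ee] [e2 [[x2 D1 U2] ee2] D2] xy; split=> //; subst b1 e2 y.
  have e1e := goes_inj L2 L1; subst e1; have x2y := goes_inj D1 D2; subst x2.
  by exists x1, e, b.
case=> <- [x' [e [b [[sq1 sq2 sq3 sq4 sq5 sq6] sb ee]]]]; split=> //.
exists x' => //; exists b => //; exists b; first exact/eval_yes.
exists b; first by split=> //; exists e.
exists e => //; exists e; first exact/eval_yes.
by exists e => //; split=> //; exists x.
Qed.

(** Once the way back is known to lead to [x], the loop can fail only because of the marks. *)
Lemma eval_transfer i p1 p2 p3 x s t y :
  (forall z, eval v p1 x z <-> z = s) -> (forall z, eval v p2 s z <-> z = t) ->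
  eval v p3 t x ->
  eval v (transfer i p1 p2 p3) x y <->
    x = y /\ (holds (reg i) s <-> holds (reg i) t).
Proof.
move=> h1 h2 h3; split.
  case=> -[s' /h1 ss' ite_s]; subst s'.
  case: ite_s => -[s1 hs [t1 h21 [t2 ht _]]] xy.
    by case/eval_yes: hs h21 => <- hs /h2 tt; case/eval_yes: ht => _; rewrite tt.
  by case/eval_no: hs h21 => <- hs /h2 tt; case/eval_no: ht => _; rewrite tt.
case=> <- st; split=> //; exists s; first exact/h1.
have [hs|hs] := pselect (holds (reg i) s); [left|right].
  exists s; first exact/eval_yes.
  by exists t; [exact/h2 | exists t => //; apply/eval_yes; split=> //; apply/st].
exists s; first exact/eval_no.
by exists t; [exact/h2 | exists t => //; apply/eval_no; split=> // /st].
Qed.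

Lemma eval_check_reg r inc i x x' e b y : square x x' e b ->
  eval v (check_reg r inc i) x y <-> x = y /\
    (if i != r then holds (reg i) x <-> holds (reg i) e
     else if inc then holds (reg i) x <-> holds (reg i) b
     else holds (reg i) x' <-> holds (reg i) e).
Proof.
case=> sq1 sq2 sq3 sq4 sq5 sq6; rewrite /check_reg.
have one z : eval v One x z <-> z = x by split=> /= ->.
case: ifP => _; last case: ifP => _; apply: eval_transfer => //.
- by move=> z; apply: eval_act.
- move=> z; split=> [[a /(eval_act _ sq1)-> /(eval_act _ sq3)] //|->].
  by exists x'.
- by exists e.
- by move=> z; apply: eval_act.
- move=> z; split=> [[a /(eval_act _ sq3)-> /(eval_act _ sq5)] //|->].
  by exists b.
Qed.

Lemma eval_check_regs k r inc x x' e b y : square x x' e b ->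
  eval v (seqs [seq check_reg r inc i | i <- iota 0 k]) x y <-> x = y /\
    forall i, i < k ->
    (if i != r then holds (reg i) x <-> holds (reg i) e
     else if inc then holds (reg i) x <-> holds (reg i) b
     else holds (reg i) x' <-> holds (reg i) e).
Proof.
move=> sq; rewrite (eval_seqs _ _ (fun i z => eval_check_reg r inc i z sq)).
by split=> -[-> h]; split=> // i; move: (h i); rewrite mem_iota.
Qed.

Lemma eval_check_head r inc x y : eval v (check_head r inc) x y <->
  x = y /\ exists e, [/\ goes 2 x e, goes 3 e x, ~ holds nstart e
                       & inc -> holds (reg r) e].
Proof.
rewrite /check_head; split.
  case=> -[e U1 [_ /eval_no[<- se] [e' h D]]] xy; subst y; split=> //; exists e.
  have ee' : e = e' by case: inc h => [/eval_yes[]|].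
  by rewrite -ee' in D; split=> //; case: inc h => // /eval_yes[].
case=> <- [e [U1 D1 se re]]; split=> //; exists e => //; exists e; first exact/eval_no.
by exists e => //; case: inc re => // re; apply/eval_yes; split=> //; apply: re.
Qed.

Lemma eval_check_last k x y : eval v (check_last k) x y <->
  x = y /\ exists e, [/\ goes 2 x e, goes 3 e x, ~ holds nend e
                       & forall i, i < k -> ~ holds (reg i) e].
Proof.
split.
  case=> -[e U1 [_ /eval_no[<- se] [_ /eval_zeros[<- ze] D]]] xy; subst y.
  by split=> //; exists e.
case=> <- [e [U1 D1 se re]]; split=> //; exists e => //; exists e; first exact/eval_no.
by exists e => //; apply/eval_zeros.
Qed.

(* Register [i] holding [c i] is encoded on the row [X 0, ..., X n] in unary:
   its mark is on the first [c i] points. *)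
Record row k n (c : state) x (X : nat -> B) : Prop := Row {
  row0 : X 0 = x;
  row_right : forall j, j < n -> goes 0 (X j) (X j.+1);
  row_left : forall j, j < n -> goes 1 (X j.+1) (X j);
  row_nend : forall j, j < n -> holds nend (X j);
  row_nstart : forall j, j < n -> holds nstart (X j.+1);
  row_start : ~ holds nstart (X 0);
  row_end : ~ holds nend (X n);
  row_reg : forall i j, i < k -> j <= n -> holds (reg i) (X j) <-> j < c i;
  row_le : forall i, i < k -> c i <= n }.

Lemma go_back_row n (X : nat -> B) y :
  (forall j, j < n -> goes 1 (X j.+1) (X j)) -> ~ holds nstart (X 0) ->
  (forall j, j < n -> holds nstart (X j.+1)) ->
  eval v go_back (X n) y -> y = X 0.
Proof.
move=> lX s0 sX h; have [||[[|j] jn ->] // []] :=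
  @while_inv (fun z => exists2 j, j <= n & z = X j) _ _ _ _ _ _ h.
- move=> z z' [[|j] jn ->] // _ /(goes_inj (lX _ jn)) <-.
  by exists j => //; apply: ltnW.
- by exists n.
- exact: sX.
Qed.

Lemma go_back_eval n (X : nat -> B) :
  (forall j, j < n -> goes 1 (X j.+1) (X j)) -> ~ holds nstart (X 0) ->
  (forall j, j < n -> holds nstart (X j.+1)) -> eval v go_back (X n) (X 0).
Proof.
move=> lX s0 sX; have := @while_chain nstart left (fun j => X (n - j)) n.
rewrite subn0 subnn; apply=> // j jn; rewrite (_ : n - j = (n - j.+1).+1); last by lia.
by split; [apply: sX | apply: lX]; lia.
Qed.

(** A total function extending the move, so that the points of a row can be named before it is known
    that the moves between them exist. *)
Lemma successor_function n : exists f : B -> B, forall x y, goes n x y -> f x = y.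
Proof.
suff /choice[f fP] : forall x, exists y, forall z, goes n x z -> y = z by exists f.
move=> x; have [[y xy]|nxy] := pselect (exists y, goes n x y).
  by exists y => z; apply: goes_inj.
by exists x => z xz; case: nxy; exists z.
Qed.

Lemma init_sound k x y : eval v (init k) x y ->
  exists n X, row k n (fun=> 0) y X.
Proof.
case/eval_seq=> _ /eval_no[<- x0] /eval_seq[z wz /eval_seq[_ /eval_zeros[<- zz] bk]].
have [f fP] := successor_function 0; pose X j := iter j f x.
have [||[n [zE Xn]] zn] := @while_inv (fun z => exists n, z = X n /\ forall j, j < n ->
  [/\ goes 0 (X j) (X j.+1), goes 1 (X j.+1) (X j), holds nend (X j), holds nstart (X j.+1)
    & forall i, i < k -> ~ holds (reg i) (X j)]) _ _ _ _ _ _ wz.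
- move=> a b [n [-> Xn]] en /eval_seq[_ /eval_zeros[<- zn] /eval_seq[c' []]].
  move=> [c R1 [_ /eval_yes[<- sc] L1]] cc'; subst c' => R2.
  have bc := goes_inj R2 R1; subst c; have bE : X n.+1 = b by rewrite /X iterS; apply: fP.
  exists n.+1; split=> // j; rewrite ltnS leq_eqVlt => /predU1P[->|/Xn //].
  by rewrite bE.
- by exists 0.
subst z; exists n, X.
have yE : y = X 0 by apply: go_back_row bk => // j jn; have [] := Xn j jn.
split=> //; try by move=> j jn; have [] := Xn j jn.
move=> i j ik; rewrite ltn0 leq_eqVlt => /predU1P[->|jn]; split=> //.
  by move/(zz i ik).
by have [_ _ _ _ h] := Xn j jn; move/(h i ik).
Qed.

Lemma update_sound k n c x y X r (inc : bool) :
  r < k -> row k n c x X -> eval v (update k r inc) x y ->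
  exists Y, row k n (upd c r (if inc then (c r).+1 else (c r).-1)) y Y.
Proof.
move=> rk [X0 rX lX eX sX s0 en mX cn]; rewrite -X0.
case/eval_seq=> _ /eval_check_head[<- [e [U0 D0 se re]]] /eval_seq[z wz].
case/eval_seq=> _ /eval_check_last[<- [e' [U' D' ee' ze']]] /eval_seq[z' bz Uy].
pose body : term := grid ;; seqs [seq check_reg r inc i | i <- iota 0 k].
(* The invariant records that all checks succeeded at each point passed; the squares of the new row
   are extracted from it after the walk. *)
have [||[m [mn zE bodyX]] ez] := @while_inv (fun z => exists m, [/\ m <= n, z = X m &
    forall j, j < m -> eval v body (X j) (X j)]) _ _ _ _ _ _ wz.
- move=> a b [m [mn -> bX]] em /eval_seq[_ /eval_grid[<- [x' [e1 [b1 [sq sb se1]]]]]].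
  case/eval_seq=> a' cha R1.
  have ma : X m = a'.
    by case/(eval_check_regs _ _ _ _ sq): cha.
  have mn' : m < n.
    rewrite ltn_neqAle mn andbT; apply/eqP => mn'; by rewrite mn' in em.
  subst a'; exists m.+1; split=> //; first exact: goes_inj (rX _ mn').
  move=> j; rewrite ltnS leq_eqVlt => /predU1P[->|/bX //].
  exists (X m) => //; apply/eval_grid; split=> //.
  by exists x', e1, b1.
- by exists 0.
have mn' : m = n.
  apply/eqP; rewrite eqn_leq mn leqNgt; apply/negP => /eX.
  by rewrite -zE.
subst m z.
have z'0 := go_back_row lX s0 sX bz; subst z'.
have ye := goes_inj Uy U0; subst e.
(* The new row is the image of the old one under [up]. Consecutive squares agree on their common
   edge because [up] is a function. *)
have [u uP] := successor_function 2.
pose Y j := u (X j); have Y0 : Y 0 = y by apply: uP.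
have Yn : Y n = e' by apply: uP.
have sq j : j < n -> [/\ square (X j) (X j.+1) (Y j) (Y j.+1), holds nstart (Y j.+1),
    holds nend (Y j) & forall i, i < k ->
    if i != r then holds (reg i) (X j) <-> holds (reg i) (Y j)
     else if inc then holds (reg i) (X j) <-> holds (reg i) (Y j.+1)
     else holds (reg i) (X j.+1) <-> holds (reg i) (Y j)].
  move=> jn; have [_ /eval_grid[<- [x' [e1 [b1 [sq sb se1]]]]]] := bodyX j jn.
  case/(eval_check_regs _ _ _ _ sq)=> _ regs.
  have xx' := goes_inj (sq_right sq) (rX _ jn); subst x'.
  have e1E : Y j = e1 by apply: uP (sq_up sq).
  have b1E : Y j.+1 = b1 by apply: uP (sq_up' sq).
  rewrite e1E b1E; by split.
(* The squares settle all but one column: the first for the incremented register, where [check_head]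
   decides, and the last for all others, where [check_last] does. *)
have regY i j : i < k -> j <= n ->
    holds (reg i) (Y j) <-> j < upd c r (if inc then (c r).+1 else (c r).-1) i.
  move=> ik jn; rewrite /upd; case: (eqVneq i r) => [->|ir]; first case ic: inc.
  - case: j jn => [|j] jn; first by rewrite Y0; split=> // _; apply: re; rewrite ic.
    have [_ _ _ /(_ r rk)] := sq j jn; rewrite eqxx ic /= => <-.
    by rewrite mX // ltnW.
  - move: jn; rewrite leq_eqVlt => /predU1P[->|jn].
      rewrite Yn; split=> [/(ze' r rk)//|]; have := cn r rk; lia.
    have [_ _ _ /(_ r rk)] := sq j jn; rewrite eqxx ic /= => <-.
    by rewrite mX //; split; lia.
  - move: jn; rewrite leq_eqVlt => /predU1P[->|jn].
      rewrite Yn; split=> [/(ze' i ik)//|]; have := cn i ik; lia.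
    have [_ _ _ /(_ i ik)] := sq j jn; rewrite ir => <-.
    by rewrite mX // ltnW.
exists Y; split=> //.
- by move=> j jn; have [[]] := sq j jn.
- by move=> j jn; have [[]] := sq j jn.
- by move=> j jn; have [] := sq j jn.
- by move=> j jn; have [] := sq j jn.
- by rewrite Y0.
- by rewrite Yn.
- move=> i ik; rewrite leqNgt; apply/negP => /(regY i n ik (leqnn n)).
  by rewrite Yn; apply: ze'.
Qed.

Lemma encode_sound k n p c x y X : registers_below k p ->
  row k n c x X -> eval v (encode k p) x y ->
  exists c' Y, run p c c' /\ row k n c' y Y.
Proof.
elim: p c x y X => [|i|i|p IHp q IHq|i p IHp] c x y X /=.
- by move=> _ cX <-; exists c, X; split=> //; exists [::] => //; apply: exec_skip.
- move=> ik cX h; have [Y cY] := update_sound (inc := true) ik cX h.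
  by eexists; exists Y; split; first exact: run_inc.
- move=> ik cX h; have [Y cY] := update_sound (inc := false) ik cX h.
  by eexists; exists Y; split; first exact: run_dec.
- case/andP=> pk qk cX [z /(IHp _ _ _ _ pk cX)[c1 [Z [r1 cZ]]]].
  move/(IHq _ _ _ _ qk cZ)=> [c2 [Y [r2 cY]]].
  by exists c2, Y; split=> //; apply: run_comp r1 r2.
case/andP=> ik pk cX h.
(* The invariant looks forward: any run of the loop from the current state extends backwards to one
   from [c]. The empty run available on exit then gives the result. *)
have [||[c' [Y [cY runY]]] ny] := @while_inv (fun z => exists c' Z, row k n c' z Z /\
    forall c'', run (Loop i p) c' c'' -> run (Loop i p) c c'') _ _ _ _ _ _ h.
- move=> a b [c1 [Y [cY runY]]] ra /(IHp _ _ _ _ pk cY)[c2 [Z [r2 cZ]]].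
  exists c2, Z; split=> // c3 r3; apply: runY; apply: run_step r2 r3.
  have := row_reg cY ik (leq0n n); rewrite (row0 cY); case: (c1 i) => // h'.
  by have := h'.1 ra.
- by exists c, X.
exists c', Y; split=> //; apply: runY; apply: run_exit; apply/eqP.
rewrite -leqn0 leqNgt; apply/negP => /(row_reg cY ik (leq0n n)).
by rewrite (row0 cY).
Qed.

(** * Computations laid out on a grid *)

Section Completeness.
Variables (k n : nat) (H : nat -> state) (X : nat -> nat -> B).
Hypotheses (X_right : forall t j, goes 0 (X t j) (X t j.+1))
  (X_left : forall t j, goes 1 (X t j.+1) (X t j))
  (X_up : forall t j, goes 2 (X t j) (X t.+1 j))
  (X_down : forall t j, goes 3 (X t.+1 j) (X t j))
  (X_nstart : forall t j, holds nstart (X t j) <-> 0 < j)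
  (X_nend : forall t j, holds nend (X t j) <-> j < n)
  (X_reg : forall t i j, holds (reg i) (X t j) <-> j < H t i)
  (H_le : forall t i, i < k -> H t i <= n).

Lemma go_back_complete t : eval v go_back (X t n) (X t 0).
Proof. by apply: go_back_eval => // [|j _]; rewrite X_nstart. Qed.

Lemma init_complete : H 0 = (fun=> 0) -> eval v (init k) (X 0 0) (X 0 0).
Proof.
move=> H0; have zX j : eval v (zeros k) (X 0 j) (X 0 j).
  by apply/eval_zeros; split=> // i _; rewrite X_reg H0.
apply/eval_seq; exists (X 0 0); first by apply/eval_no; rewrite X_nstart.
apply/eval_seq; exists (X 0 n).
  apply: while_chain => [j jn|]; last by rewrite X_nend ltnn.
  split; first by rewrite X_nend.
  apply/eval_seq; exists (X 0 j); first exact: zX.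
  apply/eval_seq; exists (X 0 j); last exact: X_right.
  split=> //; apply/eval_seq; exists (X 0 j.+1); first exact: X_right.
  apply/eval_seq; exists (X 0 j.+1); last exact: X_left.
  by apply/eval_yes; rewrite X_nstart.
by apply/eval_seq; exists (X 0 n); [exact: zX | exact: go_back_complete].
Qed.

Lemma update_complete t r (inc : bool) : r < k ->
  H t.+1 = upd (H t) r (if inc then (H t r).+1 else (H t r).-1) ->
  eval v (update k r inc) (X t 0) (X t.+1 0).
Proof.
move=> rk Ht; apply/eval_seq; exists (X t 0).
  apply/eval_check_head; split=> //; exists (X t.+1 0); split=> //; first by rewrite X_nstart.
  by move=> ic; rewrite X_reg Ht /upd eqxx ic.
apply/eval_seq; exists (X t n).
  apply: while_chain => [j jn|]; last by rewrite X_nend ltnn.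
  have sq : square (X t j) (X t j.+1) (X t.+1 j) (X t.+1 j.+1) by [].
  split; first by rewrite X_nend.
  apply/eval_seq; exists (X t j).
    apply/eval_grid; split=> //; do 3!eexists; split; first exact: sq.
      by rewrite X_nstart.
    by rewrite X_nend.
  apply/eval_seq; exists (X t j); last exact: X_right.
  apply/(eval_check_regs _ _ _ _ sq); split=> // i ik.
  case: (eqVneq i r) => [->|ir] /=; last by rewrite !X_reg Ht /upd (negPf ir).
  by case: inc Ht => Ht; rewrite !X_reg Ht /upd eqxx; split; lia.
apply/eval_seq; exists (X t n).
  apply/eval_check_last; split=> //; exists (X t.+1 n); split=> //; first by rewrite X_nend ltnn.
  by move=> i ik; rewrite X_reg; have := H_le t.+1 ik; lia.
by apply/eval_seq; exists (X t 0); [exact: go_back_complete | exact: X_up].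
Qed.

(** Each state in the history takes one new row, while tests of guards stay on the current one;
    hence the climb by [size h] rows. *)
Lemma encode_complete p s h t : registers_below k p -> exec p s h ->
  (forall j, j <= size h -> H (t + j) = nth s (s :: h) j) ->
  eval v (encode k p) (X t 0) (X (t + size h) 0).
Proof.
move=> + e; elim: e t => {p s h}
  [s|i s|i s|p q s h h' e IHp e' IHq|i p s si|i p s h h' si e IHp e' IHq] t /=.
- by rewrite addn0.
- move=> ik Hh; rewrite addn1; apply: (update_complete (inc := true)) => //.
  by have := Hh 0 isT; have := Hh 1 isT; rewrite addn1 addn0 /= => -> ->.
- move=> ik Hh; rewrite addn1; apply: (update_complete (inc := false)) => //.
  by have := Hh 0 isT; have := Hh 1 isT; rewrite addn1 addn0 /= => -> ->.
- case/andP=> pk qk Hh; rewrite size_cat addnA; exists (X (t + size h) 0).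
    apply: IHp => // j jh; rewrite Hh ?size_cat; last by lia.
    by rewrite -cat_cons nth_cat /= ltnS jh.
  apply: IHq => // j jh'; rewrite -addnA Hh ?size_cat; last by lia.
  exact: nth_cons_cat.
- case/andP=> ik pk Hh; have := Hh 0 isT; rewrite /= addn0 => Ht.
  exists (X t 0); first exact: rt_refl.
  by apply/eval_no; rewrite X_reg Ht si.
- move=> /[dup] ipk /andP[ik pk] Hh; have := Hh 0 isT; rewrite /= addn0 => Ht.
  rewrite size_cat addnA.
  have [||z st nz] := IHq (t + size h) _ _ => //.
    move=> j jh'; rewrite -addnA Hh ?size_cat; last by lia.
    exact: nth_cons_cat.
  exists z => //; apply: rt_trans st; apply: rt_step; exists (X t 0).
    apply/eval_yes; rewrite X_reg Ht lt0n.
    by split=> //; apply/eqP.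
  apply: IHp => // j jh; rewrite Hh ?size_cat; last by lia.
  by rewrite -cat_cons nth_cat /= ltnS jh.
Qed.

End Completeness.
End Semantics.
End Encoding.

(** * Reduction *)

Lemma run_loop_inv i p (I : state -> Prop) :
  (forall s s', I s -> run p s s' -> I s') ->
  forall s s', run (Loop i p) s s' -> I s -> I s' /\ s' i = 0.
Proof.
move=> Ip s s' [h e <-]; move eq: (Loop i p) e => q e.
elim: e eq => {q s h} // [j q s si|j q s h h' si e1 _ e2 IH] [ij pq] Is; subst j q => //.
by rewrite last_cat; apply: IH => //; apply: Ip Is _; exists h.
Qed.

(** Unbounded search: register 0 keeps the argument, register 1 the candidate, register 2 the truth
    value of [r], and scratch space starts at 3. The loop goes on while [r] is true. *)
Lemma search_program (r : rel nat) : recursive_rel r ->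
  exists p, forall s, s 1 = 0 -> (exists s', run p s s') <-> exists y, ~~ r (s 0) y.
Proof.
move=> /recursive_compilable /(_ [tuple 0; 1] 2 3)[]//.
  by move=> j; rewrite !inE => /orP[]/eqP->.
move=> pf pfP0; have {pfP0}pfP s : exists2 s', run pf s s' &
    [/\ s' 0 = s 0, s' 1 = s 1 & s' 2 = r (s 0) (s 1)].
  have [s' r1 [e2 e]] := pfP0 s; exists s' => //; split; try exact: e.
  by rewrite e2 !tnth_map.
exists (Comp pf (Loop 2 (Comp (Inc 1) pf))) => s s1; split.
  case=> s' /run_compE[s2 r1 r2].
  have pfE t t' : run pf t t' -> [/\ t' 0 = t 0, t' 1 = t 1 & t' 2 = r (t 0) (t 1)].
    by move=> rt; have [t2 /(run_inj rt)<-] := pfP t.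
  have [||[e0 e2] e] := @run_loop_inv _ _
    (fun t => t 0 = s 0 /\ t 2 = r (t 0) (t 1)) _ _ _ r2.
  - move=> t t' [t0 t2] /run_compE[t1 [h eh <-] /pfE[]].
    by inversion eh; subst => /= -> -> ->.
  - by have [-> -> ->] := pfE _ _ r1.
  by exists (s' 1); move: e; rewrite e2 e0; case: (r _ _).
move=> exy; have [y ny ymin] := ex_minnP exy.
have [t r1 [t0 t1 t2]] := pfP s.
have [|||t' r2 _] := @run_loop 2 (Comp (Inc 1) pf) (fun m t' =>
  [/\ t' 0 = s 0, t' 1 + m = y & t' 2 = r (t' 0) (t' 1)]) _ _ y t.
- by move=> t' [-> + ->]; rewrite addn0 => ->; case: (r _ _) ny.
- move=> m t' [t'0 t'1 t'2]; split.
    rewrite t'2 t'0; case rE: (r _ _) => //.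
    by have := ymin (t' 1); rewrite rE => /(_ isT); lia.
  have [u ru [u0 u1 u2]] := pfP (upd t' 1 (t' 1).+1).
  exists u; first exact: run_comp (run_inc _ _) ru.
  by rewrite u2 u0 u1 /upd /=; split=> //; lia.
- by rewrite t1 s1 t0 t2 s1.
by exists t'; apply: run_comp r1 r2.
Qed.

(** The argument enters the program as [x] increments. The code of the resulting term is thus
    obtained by iterating a fixed recursive step, which makes the reduction recursive. *)
Definition input x p : cmd := iter x (Comp (Inc 0)) p.

Lemma run_input x p s s' : run (input x p) s s' <-> run p (upd s 0 (s 0 + x)) s'.
Proof.
elim: x s => [|x IH] s.
  suff -> : upd s 0 (s 0 + 0) = s by [].
  by apply/funext => j; rewrite /upd addn0; case: eqP => [->|].
have -> : upd s 0 (s 0 + x.+1) = upd (upd s 0 (s 0).+1) 0 (upd s 0 (s 0).+1 0 + x).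
  by apply/funext => j; rewrite /upd eqxx; case: eqP => // _; rewrite addnS.
split=> [/run_compE[t /(run_inj (run_inc _ _))<- /IH //]|/IH h].
exact: run_comp (run_inc _ _) h.
Qed.

Lemma registers_below_leq k k' p : k <= k' -> registers_below k p -> registers_below k' p.
Proof.
move=> kk'; elim: p => //= [i|i|p IHp q IHq|i p IHp].
- by move=> ik; apply: leq_trans kk'.
- by move=> ik; apply: leq_trans kk'.
- by case/andP=> /IHp-> /IHq->.
- by case/andP=> ik /IHp->; rewrite (leq_trans ik).
Qed.

Lemma registers_below_ex p : exists k, registers_below k p.
Proof.
elim: p => [|i|i|p [k kp] q [k' kq]|i p [k kp]] /=.
- by exists 0.
- by exists i.+1.
- by exists i.+1.
- by exists (maxn k k'); rewrite !(registers_below_leq _ kp, registers_below_leq _ kq) //;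
    [apply: leq_maxr | apply: leq_maxl].
- by exists (maxn k i.+1); rewrite (registers_below_leq _ kp) ?leq_maxl // leq_maxr.
Qed.

(** Provides a length of row that accommodates all counters throughout a halting computation. *)
Lemma states_bounded k (s0 : state) h :
  exists n, forall t i, i < k -> nth s0 h t i <= n.
Proof.
have bnd (s : state) : exists n, forall i, i < k -> s i <= n.
  exists (\max_(i < k) s i) => i ik.
  exact: (leq_bigmax (Ordinal ik)).
have [n0 n0P] := bnd s0.
elim: h => [|s h [n IH]]; first by exists n0 => t i ik; rewrite nth_nil; apply: n0P.
have [m mP] := bnd s; exists (maxn m n) => -[|t] i ik /=; rewrite leq_max.
  by rewrite mP.
by rewrite IH ?orbT.
Qed.

(** * Infinitely many pairwise independent primitive tests *)

Section Marks.
Variables (P : Type) (tilde : P -> P) (codeP : P -> nat).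
Hypotheses (codeP_bij : bijective codeP) (tildeK : involutive tilde)
  (tilde_free : forall p, tilde p <> p).

(** The tests are taken from different pairs formed by [p] and [tilde p]. The smaller code in the
    pair, [cl], depends only on the pair and increases strictly along the sequence. *)
Lemma marks_exist : exists mark : nat -> P,
  injective mark /\ forall i j, mark i <> tilde (mark j).
Proof.
have [K codePK KcodeP] := codeP_bij.
pose cl p := minn (codeP p) (codeP (tilde p)).
have cl_tilde p : cl (tilde p) = cl p by rewrite /cl tildeK minnC.
have /choice[f fP] : forall N, exists p, N <= cl p.
  (* [M] bounds the codes of the complements of the tests coded below [N]. A test with code above
     [M] is none of these complements, so its own complement is not coded below [N]. *)
  move=> N; pose M := \max_(i < N) codeP (tilde (K i)).
  exists (K (maxn N M.+1)); set p := K _.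
  have pE : codeP p = maxn N M.+1 by apply: KcodeP.
  rewrite leq_min pE leq_maxl /= leqNgt; apply/negP => lt.
  have := leq_bigmax (F := fun i : 'I_N => codeP (tilde (K i))) (Ordinal lt).
  by rewrite /= codePK tildeK pE -/M; lia.
pose mark i := f (iter i (fun N => (cl (f N)).+1) 0).
have lt_cl : {homo (cl \o mark) : i j / i < j}.
  by apply: homo_ltn => [|i]; [exact: ltn_trans | exact: fP].
have cl_inj i j : cl (mark i) = cl (mark j) -> i = j.
  by move=> e; case: (ltngtP i j) => // /lt_cl /=; rewrite e ltnn.
exists mark; split=> [i j /(congr1 cl)/cl_inj //|i j e].
have ij : i = j by apply: cl_inj; rewrite e cl_tilde.
by move: e; rewrite ij => /esym/tilde_free.
Qed.

End Marks.

(** * The infinite grid as a structure *)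

Section GridModel.
Variables (P A : Type) (tilde : P -> P) (codeP : P -> nat).
Hypotheses (codeP_inj : injective codeP) (tildeK : involutive tilde)
  (tilde_free : forall p, tilde p <> p).
Variables (mark : nat -> P) (move : nat -> A).
Hypotheses (mark_inj : injective mark) (mark_tilde : forall i j, mark i <> tilde (mark j))
  (move_inj : injective move).
Variables (n : nat) (H : nat -> state).

Definition grid_mark i (x : nat * nat) : bool :=
  match i with 0 => 0 < x.2 | 1 => x.2 < n | i.+2 => x.2 < H x.1 i end.

Definition grid_move i (x y : nat * nat) : Prop :=
  match i with
  | 0 => y = (x.1, x.2.+1)
  | 1 => x = (y.1, y.2.+1)
  | 2 => y = (x.1.+1, x.2)
  | _ => x = (y.1.+1, y.2)
  end.

(** Only the marks and their complements are decided here; the remaining primitive tests are left to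
    [extend_val]. *)
Definition grid_val : valuation P A (nat * nat) := fun a x y =>
  match a with
  | inl p => x = y /\ ((exists2 i, p = mark i & grid_mark i x) \/
                       exists2 i, p = tilde (mark i) & ~~ grid_mark i x)
  | inr a => exists2 i, a = move i & grid_move i x y
  end.

Lemma grid_val_excl p x : grid_val (inl p) x x -> ~ grid_val (inl (tilde p)) x x.
Proof.
case=> _ [[i -> mi]|[i -> mi]] [_ [[j e mj]|[j e mj]]].
- by case: (mark_tilde (esym e)).
- by have ij : i = j; [apply: mark_inj; apply: (inv_inj tildeK) | subst j; rewrite mi in mj].
- by move: e; rewrite tildeK => /mark_inj ij; subst j; rewrite mj in mi.
- by move: e; rewrite tildeK => /mark_tilde.
Qed.

Definition grid_model : valuation P A (nat * nat) := extend_val tilde codeP grid_val.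

Lemma grid_model_drel : drel_test tilde grid_model.
Proof.
apply: extend_val_drel => //; last exact: grid_val_excl.
move=> a [x1 x2] [y1 y2] [z1 z2] [i -> xy] [j /move_inj ij xz]; subst j.
by case: i xy xz => [|[|[|i]]] /= [-> ->] [-> ->].
Qed.

Lemma grid_model_goes i x y : grid_move i x y -> goes move grid_model i x y.
Proof. by exists i. Qed.

(** Since [grid_val] makes either the mark or its complement true at every point, the extension
    cannot add a mark. *)
Lemma grid_model_holds i x : holds grid_model (mark i) x <-> grid_mark i x.
Proof.
have sub a x y := @extend_val_sub _ _ _ tilde codeP grid_val _ a x y.
split; last first.
  move=> m; apply: sub => [p y z []//|]; split=> //; left; by exists i.
move=> h; apply/negPn/negP => m.
have [_ _ _ /(_ (mark i) x x)[+ _]] := grid_model_drel.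
case=> //; apply: sub => [p y z []//|]; split=> //; right; by exists i.
Qed.

End GridModel.

(** * The many-one reduction *)

Section Reduction.
Variables (P A : Type) (tilde : P -> P) (codeP : P -> nat) (codeA : A -> nat).
Hypotheses (codeP_bij : bijective codeP) (codeA_bij : bijective codeA)
  (tildeK : involutive tilde) (tilde_free : forall p, tilde p <> p).
Variable tildec : nat -> nat.
Hypotheses (rec_tildec : recursive1 tildec)
  (tildecP : forall p, codeP (tilde p) = tildec (codeP p)).

Lemma emptiness_hard (K : forall B : Type, valuation P A B -> Prop) S :
  (forall B v, K B v -> drel_test tilde v) ->
  (forall B v, drel_test_fin tilde v -> K B v) ->
  Pi01 S -> many_one_reducible S (emptiness_problem tilde codeP codeA K).
Proof.
move=> Kdrel finK [r /search_program[p pP] SP].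
have [k kp0] := registers_below_ex p.
(* The successor ensures that register 0, incremented by [input], is among those encoded. *)
have {kp0}kp : registers_below k.+1 p by apply: registers_below_leq kp0.
have [mark [mark_inj mark_tilde]] := marks_exist codeP_bij tildeK tilde_free.
have [move _ moveK] := codeA_bij; have move_inj := can_inj moveK.
pose enc q := encode tilde mark move k.+1 q.
pose T x := Seq (init tilde mark move k.+1) (enc (input x p)).
have kin x : registers_below k.+1 (input x p) by elim: x.
have runP x : (exists s', run (input x p) (fun=> 0) s') <-> exists y, ~~ r x y.
  rewrite -[x in r x]/(upd (fun=> 0) 0 (0 + x) 0) -pP //.
  by split=> -[s' rs]; exists s'; apply/run_input.
have emptyP x : empty_on K (T x) <-> forall y, r x y.
  split=> [Te|rx B v /Kdrel vd a b /eval_seq[c /(init_sound vd)[n [X rX]] ev]].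
    move=> y; apply/negPn/negP => nr.
    have [s' [h e _]] : exists s', run (input x p) (fun=> 0) s' by apply/runP; exists y.
    pose H := nth (fun=> 0) ((fun=> 0) :: h).
    have [n nP] := states_bounded k.+1 (fun=> 0) ((fun=> 0) :: h).
    pose v : valuation P A _ := grid_model tilde codeP mark move n H.
    have vd : drel_test tilde v by apply: grid_model_drel => //; exact: bij_inj.
    have goesP i a b : grid_move i a b -> goes move v i a b by apply: grid_model_goes.
    have holdsP i a : holds v (mark i) a <-> grid_mark n H i a.
      by apply: grid_model_holds => //; exact: bij_inj.
    have ev : eval v (T x) (0, 0) (size h, 0).
      apply/eval_seq; exists (0, 0).
        by apply: (@init_complete _ _ _ mark move _ v vd k.+1 n H (fun t j => (t, j)));
          do ?[by move=> *; apply: goesP | by move=> *; apply: holdsP | by []].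
      by have := @encode_complete _ _ _ mark move _ v vd k.+1 n H (fun t j => (t, j))
        _ _ _ _ _ _ _ _ _ _ h 0 (kin x) e; rewrite add0n; apply;
        do ?[by move=> *; apply: goesP | by move=> *; apply: holdsP | by [] | exact: nP].
    (* The grid is infinite and need not belong to [K]; a certificate extracted from it gives a
       finite structure that does. *)
    have [y' yP] := model_cert codeP_bij codeA_bij tildecP vd ev.
    have [B [w [/finK wK [a [b ab]]]]] :=
      cert_finite_model codeP_bij tildeK tilde_free tildecP yP.
    exact: Te wK a b ab.
  have [c' [Y [rc _]]] := encode_sound vd (kin x) rX ev.
  have [y /negP[]] : exists y, ~~ r x y by apply/runP; exists c'.
  exact: rx.
pose c0 := code codeP codeA (init tilde mark move k.+1).
pose c1 := code codeP codeA (enc (Inc 0)).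
(* The code of [T x] in closed form: 4 is the tag of composition, and every unit of [x] prefixes one
   more encoded increment. *)
exists (fun x => cpair 4 (cpair c0 (nat_rect (fun=> nat) (code codeP codeA (enc p))
  (fun _ c => cpair 4 (cpair c1 c)) x))).
  apply: rec_cpair (rec_const _) (rec_cpair (rec_const _) _).
  apply: (rec_nat_rect (h := fun _ _ c => cpair 4 (cpair c1 c))) (rec_const _) _ rec_id.
  rec_tac.
move=> x; set fx := cpair _ _.
have fxE : fx = code codeP codeA (T x).
  have inputE m : code codeP codeA (enc (input m.+1 p)) =
    cpair 4 (cpair c1 (code codeP codeA (enc (input m p)))) by [].
  rewrite -[RHS]/(cpair 4 (cpair c0 (code codeP codeA (enc (input x p))))) /fx.
  by congr (cpair 4 (cpair c0 _)); elim: (x) => [//|m IH]; rewrite inputE -IH.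
rewrite SP -emptyP fxE; split=> [Te|[t [/(code_inj codeP_bij codeA_bij)-> _]] //].
by exists (T x); split=> //; apply: pwp_seq; [exact: pwp_init | exact: pwp_encode].
Qed.

End Reduction.

Theorem theorem38 (P A : Type) (tilde : P -> P)
    (codeP : P -> nat) (codeA : A -> nat)
    (codeP_bij : bijective codeP) (codeA_bij : bijective codeA)
    (tildeK : involutive tilde) (tilde_free : forall p : P, tilde p <> p)
    (tilde_rec : exists2 g : nat -> nat,
       recursive1 g & forall p : P, codeP (tilde p) = g (codeP p)) :
  Pi01_complete
    (emptiness_problem tilde codeP codeA (@drel_test P A tilde)) /\
  Pi01_complete
    (emptiness_problem tilde codeP codeA (@drel_test_fin P A tilde)).
Proof.
have [g rec_g gP] := tilde_rec.
have fin_sub B (v : valuation P A B) : drel_test_fin tilde v -> drel_test tilde v by case.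
have mem K := emptiness_Pi01 codeP_bij codeA_bij tildeK tilde_free rec_g gP (K := K).
have hard K S := emptiness_hard codeP_bij codeA_bij tildeK tilde_free gP (K := K) (S := S).
by split; split=> [|S]; (apply: mem || apply: hard) => // B v; exact: fin_sub.
Qed.
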